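(* Let $A\in \mathrm{GL}(2,\mathbb{R})$ with $|\det(A)|\ge 1$. Let $\lambda_1,\lambda_2$ be the eigenvalues of $A$ with $|\lambda_1|\ge|\lambda_2|$. (a) If $|\lambda_1\lambda_2|=1$, i.e. $|\det(A)|=1$, then there exists no wavelet set with dilation $A$. (b) If $|\lambda_1|>1$ and $|\lambda_2|\ge 1$, then there exists a wavelet set with dilation $A$. (c) If $|\lambda_1\lambda_2|>1$ and $|\lambda_2|<1$, let $\mathbf{v}=[v_1,v_2]^T$ be an eigenvector of the transpose $A^T$ for the eigenvalue $\lambda_2$. Then there exists a wavelet set with dilation $A$ if and only if $v_1/v_2\in\mathbb{R}\setminus\mathbb{Q}$.
   Context: A collection of measurable sets $\{T_j\}$ in $\mathbb{R}^d$ is a tiling of $\mathbb{R}^d$ if the sets are pairwise disjoint in Lebesgue measure (pairwise intersections have measure zero) and their union is $\mathbb{R}^d$ up to a set of measure zero. A measurable set $T\subset\mathbb{R}^d$ tiles translationally by $\mathcal{J}\subset\mathbb{R}^d$ if $\{T+\alpha:\alpha\in\mathcal{J}\}$ is a tiling of $\mathbb{R}^d$. For $B\in\mathrm{GL}(d,\mathbb{R})$, a measurable set $T$ tiles multiplicatively by $B$ if $\{B^nT:n\in\mathbb{Z}\}$ is a tiling of $\mathbb{R}^d$. For $A\in\mathrm{GL}(d,\mathbb{R})$, a wavelet set with dilation $A$ is a measurable set $T\subset\mathbb{R}^d$ that tiles $\mathbb{R}^d$ translationally by $\mathbb{Z}^d$ and multiplicatively by the transpose $A^T$. In (c), the eigenvalues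 are necessarily real and the ratio $v_1/v_2$ does not depend on the choice of eigenvector; the condition $v_1/v_2\in\mathbb{R}\setminus\mathbb{Q}$ means that $v_2\neq 0$ and the ratio is irrational. *)

(* Defs.v *)
From HB Require Import structures.
From mathcomp Require Import all_boot all_order all_algebra.
From mathcomp Require Import all_classical all_reals all_analysis.
From mathcomp Require Import measurable_realfun complex.

Set Implicit Arguments.
Unset Strict Implicit.
Unset Printing Implicit Defensive.

Import Order.TTheory GRing.Theory Num.Theory.
Import numFieldNormedType.Exports.

Local Open Scope classical_set_scope.
Local Open Scope ring_scope.

(* The library puts its measurable structure on products rather than on column
   vectors, so Lebesgue measure on R^2 is read through coordinates. *)
Definition coords (R : realType) (x : 'cV[R]_2) :
  measurableTypeR R * measurableTypeR R := (x 0 0, x 1 0).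

Definition lebesgue_measure2 (R : realType) :
    set (measurableTypeR R * measurableTypeR R) -> \bar R :=
  (@lebesgue_measure R \x @lebesgue_measure R)%E.

(* The product sigma-algebra only contains Borel sets; the Lebesgue measurable
   sets are those of its completion. *)
Definition measurable2 (R : realType) (T : set 'cV[R]_2) : Prop :=
  completed_algebra_gen (@lebesgue_measure2 R) (@coords R @` T).

Definition null2 (R : realType) (T : set 'cV[R]_2) : Prop :=
  (@lebesgue_measure2 R).-negligible (@coords R @` T).

(* A tiling is an indexed family: sets with distinct indices must be
   essentially disjoint even if they coincide as sets. *)
Definition tiling (R : realType) (I : Type) (J : set I)
    (T : I -> set 'cV[R]_2) : Prop :=
  [/\ forall i, J i -> measurable2 (T i),
      forall i j, J i -> J j -> i <> j -> null2 (T i `&` T j)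
    & null2 (~` \bigcup_(i in J) T i)].

Definition tiles_translationally (R : realType) (J : set 'cV[R]_2)
    (T : set 'cV[R]_2) : Prop :=
  measurable2 T /\ tiling J (fun a => [set x + a | x in T]).

Definition tiles_multiplicatively (R : realType) (B : 'M[R]_2)
    (T : set 'cV[R]_2) : Prop :=
  measurable2 T /\ tiling [set: int] (fun n => [set B ^ n *m x | x in T]).

Definition integer_lattice (R : realType) : set 'cV[R]_2 :=
  [set a : 'cV[R]_2 | forall i : 'I_2, a i 0 \is a Num.int].

Definition wavelet_set (R : realType) (A : 'M[R]_2) (T : set 'cV[R]_2) : Prop :=
  tiles_translationally (@integer_lattice R) T /\
  tiles_multiplicatively A^T T.

Definition complex_mx (R : realType) (A : 'M[R]_2) : 'M[R[i]]_2 :=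
  map_mx (real_complex R) A.

Definition eigenvalues2 (R : realType) (A : 'M[R]_2) (l1 l2 : R[i]) : Prop :=
  char_poly (complex_mx A) = ('X - l1%:P) * ('X - l2%:P).

Definition eigenvector (R : realType) (A : 'M[R]_2) (l : R[i])
    (v : 'cV[R[i]]_2) : Prop :=
  v != 0 /\ complex_mx A *m v = l *: v.

(* [z / w] lies in R \ Q; [w != 0] is required because [z / 0] is [0]. *)
Definition irrational_ratio (R : realType) (z w : R[i]) : Prop :=
  w != 0 /\ exists2 r : R, irrational r & z / w = real_complex R r.

(* Main.v *)
(** The dilation [B = A^T] and the lattice Z^2 act on the plane; a wavelet set is
    a common fundamental domain [E] of both actions, up to null sets.

    (a) If [`|\det A| = 1], then [E] and its dilate by 2 are fundamental domains
    of the same measure preserving action, so they have equal finite measure.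

    Let [f] be the modulus of a left eigenform of [B] for [l1], so that
    [f (B p) = `|l1| * f p]; the annuli [c <= f < `|l1| * c] are fundamental
    domains for [B].

    (b), (c), existence. By a Cantor-Bernstein argument it is enough to find a
    fundamental domain of each action that packs for the other one. A unit square
    far from the origin lies in an annulus, hence packs for [B]. For the other
    one, if [B ^ j] maps no nonzero lattice point into the open unit square for
    infinitely many [j], then pull unit squares back by very sparse such powers
    and discard overlaps modulo Z^2. The condition on [j] can only fail if some
    nonzero lattice point is an eigenvector for [l2] with [`|l2| < 1].

    (c), obstruction. A rational ratio [v1 / v2] gives a nonzero lattice point [w]
    in the eigenline of [l2]. An annulus is covered by the sets [B ^ n E]; those
    with [n < 0] have summable measures as [1 < `|\det B|], and [B ^ n E] packs
    along [l2 ^ n * w], so for [n >= 0] it meets the annulus in measure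
    [O(`|l2| ^ n)]. But the annulus is invariant under stretching along [w], so
    its measure is infinite. *)

Require Import Defs.
From HB Require Import structures.
From mathcomp Require Import all_boot all_order all_algebra.
From mathcomp Require Import all_classical all_reals all_analysis.
From mathcomp Require Import measurable_realfun complex ring lra zify.

Set Implicit Arguments.
Unset Strict Implicit.
Unset Printing Implicit Defensive.

Import Order.TTheory GRing.Theory Num.Theory.
Import numFieldNormedType.Exports.

Local Open Scope classical_set_scope.
Local Open Scope ring_scope.

(** * Countable group actions *)

Section Actions.
Context {d : measure_display} {X : measurableType d} {I : zmodType}.
Hypothesis countI : countable [set: I].

Definition action (phi : I -> X -> X) : Prop :=
  (forall x, phi 0 x = x) /\
  (forall i j x, phi (i + j) x = phi i (phi j x)).

Definition maction (phi : I -> X -> X) : Prop :=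
  action phi /\ forall i, measurable_fun setT (phi i).

Definition sat (phi : I -> X -> X) (S : set X) : set X :=
  [set x | exists i, S (phi i x)].

(** Packing is exact, with no null set allowed; in particular the action is free on [S]. Null
    overlaps are removed beforehand, by [packing_setD_overlap]. *)
Definition packing (phi : I -> X -> X) (S : set X) : Prop :=
  forall i x, S x -> S (phi i x) -> i = 0.

Variable phi : I -> X -> X.
Hypothesis mphi : maction phi.

Lemma act0 x : phi 0 x = x. Proof. exact: mphi.1.1. Qed.

Lemma actD i j x : phi (i + j) x = phi i (phi j x).
Proof. exact: mphi.1.2. Qed.

Lemma actK i x : phi (- i) (phi i x) = x.
Proof. by rewrite -actD addNr act0. Qed.

Lemma actVK i x : phi i (phi (- i) x) = x.
Proof. by rewrite -actD addrN act0. Qed.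

Lemma measurable_act_preimage i (S : set X) :
  measurable S -> measurable (phi i @^-1` S).
Proof. by move=> mS; rewrite -[_ @^-1` _]setTI; exact: mphi.2. Qed.

Lemma measurable_sat (S : set X) : measurable S -> measurable (sat phi S).
Proof.
move=> mS; rewrite (_ : sat phi S = \bigcup_i (phi i @^-1` S)).
  by apply: countable_bigcupT_measurable => // i; exact: measurable_act_preimage.
by apply/seteqP; split=> [x [i Si]|x [i _ Si]]; exists i.
Qed.

Lemma sub_sat (S : set X) : S `<=` sat phi S.
Proof. by move=> x Sx; exists 0; rewrite act0. Qed.

Lemma sat_act (S : set X) i x : sat phi S (phi i x) -> sat phi S x.
Proof. by case=> j; rewrite -actD => ?; exists (j + i). Qed.

Lemma satS (S S' : set X) : S `<=` sat phi S' -> sat phi S `<=` sat phi S'.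
Proof. by move=> SS' x [i /SS']; exact: sat_act. Qed.

Lemma packingS (S S' : set X) : S `<=` S' -> packing phi S' -> packing phi S.
Proof. by move=> SS' pS i x /SS' Sx /SS'; exact: pS. Qed.

(* In each orbit keep the point of [G] lying in the first [W n] that meets the
   orbit inside [G]. *)
Lemma packing_selection (G : set X) (W : nat -> set X) :
  measurable G -> (forall n, measurable (W n)) ->
  (forall n, packing phi (W n)) ->
  exists P, [/\ P `<=` G, measurable P, packing phi P
    & forall n, G `&` W n `<=` sat phi P].
Proof.
move=> mG mW pW.
pose V n := (G `&` W n) `\` \bigcup_(m in `I_n) sat phi (G `&` W m).
exists (\bigcup_n V n); split.
- by move=> x [n _ [[]]].
- apply: bigcupT_measurable => n; apply: measurableD.
    exact: measurableI.
  by apply: bigcup_measurable => m _; apply/measurable_sat/measurableI.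
- move=> i x [n _ [GWx nx]] [m _ [GWy my]].
  have [nm|mn|nm] := ltngtP n m.
  + case: my; exists n => //; exists (- i); by rewrite actK.
  + case: nx; exists m => //; by exists i.
  + by subst m; apply: (pW n i x) => //; [case: GWx|case: GWy].
- move=> n0 x [Gx Wx].
  have ex : exists n, `[< sat phi (G `&` W n) x >].
    by exists n0; apply/asboolP/sub_sat.
  case: (ex_minnP ex) => n /asboolP[i GWi] minn; exists i; exists n => //.
  split=> // -[m /= mn /sat_act Gm].
  by have := minn m (asboolT Gm); rewrite leqNgt mn.
Qed.

End Actions.

(** A partial enumeration without repetition turns unions over [I] into sequences of sets, and
    disjointness survives; [None] pads the codes of no index. *)
Lemma countable_enum (I : Type) : countable [set: I] ->
  exists e : nat -> option I, (forall i, exists n, e n = Some i) /\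
    (forall n m i, e n = Some i -> e m = Some i -> n = m).
Proof.
move=> /countable_injP[f finj].
pose e n := if pselect (exists i, f i = n) is left h then Some (projT1 (cid h))
            else None.
have eE n i : (e n = Some i) <-> f i = n.
  rewrite /e; case: pselect => [h|h]; last by split=> // fi; case: h; exists i.
  case: cid => j /= fj; split=> [[<-]//|fi]; congr Some.
  by apply: finj; rewrite ?in_setT// fj fi.
exists e; split=> [i|n m i /eE <- /eE <-//].
by exists (f i); apply/eE.
Qed.

Section Measure_preserving.
Context {d : measure_display} {X : measurableType d} {R : realType} {I : zmodType}.
Hypothesis countI : countable [set: I].
Variables (mu : {measure set X -> \bar R}) (phi : I -> X -> X).
Hypothesis mphi : maction phi.
Hypothesis phi_mu : forall i (S : set X), measurable S ->
  mu (phi i @^-1` S) = mu S.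

(** Cut the left-hand set into the pieces that [phi i] moves into [S]. The moved pieces keep their
    measure, and they are disjoint because [P] packs. *)
Lemma packing_le_sat (P S : set X) : measurable P -> measurable S ->
  packing phi P -> (mu (P `&` sat phi S) <= mu S)%E.
Proof.
move=> mP mS pP; have [e [e_surj e_inj]] := countable_enum countI.
pose A n := if e n is Some i then P `&` phi i @^-1` S else set0.
(* [B n] is the image of [A n] under [phi i], written as a preimage. *)
pose B n := if e n is Some i then phi (- i) @^-1` P `&` S else set0.
have mphiS i (Y : set X) : measurable Y -> measurable (phi i @^-1` Y).
  exact: measurable_act_preimage.
have mA n : measurable (A n).
  by rewrite /A; case: (e n) => // i; apply: measurableI => //; exact: mphiS.
have mB n : measurable (B n).
  by rewrite /B; case: (e n) => // i; apply: measurableI => //; exact: mphiS.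
have AB n : mu (A n) = mu (B n).
  rewrite /A /B; case: (e n) => // i.
  rewrite -[LHS](phi_mu (- i)); last by apply: measurableI => //; exact: mphiS.
  congr (mu _); apply/seteqP; split=> x /=; rewrite (actVK mphi)//.
have tB : trivIset setT B.
  apply/trivIsetP => n m _ _ nm; apply/seteqP; split=> // x; rewrite /B.
  case en : (e n) => [i|]; last by case.
  case em : (e m) => [j|]; last by case.
  move=> [/= [Pi _] [Pj _]]; case/eqP: nm; apply: (e_inj _ _ i) => //.
  suff -> : i = j by [].
  have := pP (- j + i) _ Pi; rewrite actD// actVK// => /(_ Pj)/eqP.
  by rewrite addrC subr_eq0 => /eqP.
have -> : P `&` sat phi S = \bigcup_n A n.
  apply/seteqP; split=> x.
    move=> [Px [i Si]]; have [n en] := e_surj i; exists n => //.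
    by rewrite /A en.
  by move=> [n _]; rewrite /A; case: (e n) => [i [Px Si]|//]; split=> //; exists i.
apply: (le_trans (generalized_Boole_inequality mu mA _)).
  exact: bigcupT_measurable.
rewrite (eq_eseriesr (g := mu \o B)); last by move=> n _; exact: AB.
rewrite -measure_semi_bigcup//; last exact: bigcupT_measurable.
apply: le_measure; rewrite ?inE//; first exact: bigcupT_measurable.
by move=> x [n _]; rewrite /B; case: (e n) => [i []|].
Qed.

End Measure_preserving.

Section Two_actions.
Context {d : measure_display} {X : measurableType d} {I J : zmodType}.
Hypotheses (countI : countable [set: I]) (countJ : countable [set: J]).
Variables (phi : I -> X -> X) (psi : J -> X -> X).
Hypotheses (mphi : maction phi) (mpsi : maction psi).

(* The Cantor-Bernstein argument: [psi] injects [Q] into [P] and [phi] injects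
   [P] into [Q] (almost everywhere, in the application). [E] collects the points
   of [Q] whose chain of preimages under these injections stops in [Q]. *)
Lemma simultaneous_packing (P Q : set X) : measurable P -> measurable Q ->
  packing phi P -> packing psi P -> packing phi Q -> packing psi Q ->
  exists T, [/\ measurable T, packing phi T, packing psi T,
    sat phi Q `<=` sat phi T & sat psi P `<=` sat psi T].
Proof.
move=> mP mQ pP qP pQ qQ.
pose E := fix E n : set X := if n is n'.+1
  then sat phi (sat psi (E n') `&` P) `&` Q else Q `\` sat phi P.
have mE n : measurable (E n).
  elim: n => [|n IH] /=; first by apply: measurableD => //; exact: measurable_sat.
  apply: measurableI => //; apply: measurable_sat => //.
  by apply: measurableI => //; exact: measurable_sat.
pose Q1 := \bigcup_n E n.
have Q1Q : Q1 `<=` Q by move=> x [[|n] _ []].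
have mQ1 : measurable Q1 by exact: bigcupT_measurable.
(* Hence no point of [P] outside [sat psi Q1] shares a [phi]-orbit with [Q1]: this is why the two
   parts of the tile chosen below pack together for [phi]. *)
have bad x i : Q1 x -> P (phi i x) -> sat psi Q1 (phi i x).
  move=> [[|n] _] /=; first by move=> [_ h] Px; case: h; exists i.
  move=> [[j [[k Ek] Pj]] _] Pi.
  have ji : j = i.
    apply/eqP; rewrite -subr_eq0 addrC; apply/eqP.
    apply: (pP _ (phi i x)) => //; rewrite -actD// addrAC addNr add0r//.
  by subst j; exists k; exists n.
exists (Q1 `|` (P `\` sat psi Q1)); split.
- apply: measurableU => //; apply: measurableD => //; exact: measurable_sat.
- move=> i x [Qx|[Px nx]] [Qy|[Py ny]].
  + by apply: (pQ i x); exact: Q1Q.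
  + by case: ny; exact: bad.
  + have := bad _ (- i) Qy; rewrite actK// => /(_ Px) //.
  + exact: (pP i x).
- move=> i x [Qx|[Px nx]] [Qy|[Py ny]].
  + by apply: (qQ i x); exact: Q1Q.
  + by case: ny; exists (- i); rewrite actK.
  + by case: nx; exists i.
  + exact: (qP i x).
- apply: satS => // x Qx.
  have [Q1x|Q1x] := pselect (Q1 x); first by apply: sub_sat => //; left.
  have [[i Pi]|h] := pselect (sat phi P x); last by case: Q1x; exists 0.
  exists i; right; split=> // -[j [n _ En]]; apply: Q1x; exists n.+1 => //=.
  by split=> //; exists i; split=> //; exists j.
- apply: satS => // x Px.
  have [[i Qi]|h] := pselect (sat psi Q1 x); first by exists i; left.
  by apply: sub_sat => //; right.
Qed.

End Two_actions.

(** * Lebesgue measure on the plane and linear maps *)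

Section Plane.
Context {R : realType}.
Notation leb := (@lebesgue_measure R).
Notation X := (measurableTypeR R * measurableTypeR R)%type.

Definition affine (b c : R) (x : measurableTypeR R) : measurableTypeR R :=
  b * x + c.

Lemma measurable_affine (b c : R) : measurable_fun setT (affine b c).
Proof.
by apply: measurable_funD => //; apply: measurable_funM.
Qed.

(** By uniqueness of Lebesgue measure it suffices to compare half-open intervals. A negative [b]
    exchanges the open and the closed end, which leaves the length unchanged. *)
Lemma lebesgue_measure_affine (b c : R) (E : set (measurableTypeR R)) :
  b != 0 -> measurable E ->
  (leb E = (`|b|)%:E * leb (affine b c @^-1` E))%E.
Proof.
move=> b0 mE.
have mf := measurable_affine b c.
have -> := @lebesgue_measure_unique R
  (mscale (NngNum (normr_ge0 b)) (pushforward leb (affine b c))) _ E mE.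
  by [].
move=> _ [[p q] _ <-] /=; rewrite /mscale/= /pushforward.
have [b_gt|b_lt|] := ltrgt0P b; last by move/eqP; rewrite (negbTE b0).
- rewrite (_ : _ @^-1` _ = `](p - c) / b, (q - c) / b]%classic); last first.
    apply/seteqP; split=> x /=; rewrite /affine !in_itv/= ltr_pdivrMr// ler_pdivlMr//;
    by rewrite ltrBlDr lerBrDr (mulrC x).
  rewrite !lebesgue_measure_itv/= !lte_fin ltr_pM2r ?invr_gt0// ltrD2r.
  case: ifPn => _; last by rewrite mule0.
  by rewrite -!EFinD -EFinM; congr EFin; field.
- rewrite (_ : _ @^-1` _ = `[(q - c) / b, (p - c) / b[%classic); last first.
    apply/seteqP; split=> x /=; rewrite /affine !in_itv/= ltr_ndivlMr// ler_ndivrMr//;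
    by rewrite ltrBlDr lerBrDr (mulrC x) andbC.
  rewrite !lebesgue_measure_itv/= !lte_fin ltr_nM2r ?invr_lt0// ltrD2r.
  case: ifPn => _; last by rewrite mule0.
  by rewrite -!EFinD -EFinM; congr EFin; field.
Qed.

(** Uniqueness of the product measure allows integrating over sections in the other direction. *)
Lemma lebesgue_measure2_ysection (E : set X) : measurable E ->
  lebesgue_measure2 E = (leb \x^ leb)%E E.
Proof.
move=> mE; rewrite /lebesgue_measure2.
by apply: product_measure_unique => //= A B mA mB; rewrite product_measure2E.
Qed.

HB.instance Definition _ := Measure.on (@lebesgue_measure2 R).

(** On each vertical section [g] is affine with slope [b], so the one-dimensional formula can be
    integrated over the sections. *)
Lemma lebesgue_measure2_yaffine (b : R) (g : X -> X) (h : R -> R)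
    (E : set X) : b != 0 -> measurable_fun setT g ->
  (forall p, g p = (p.1, b * p.2 + h p.1)) -> measurable E ->
  (lebesgue_measure2 E = (`|b|)%:E * lebesgue_measure2 (g @^-1` E))%E.
Proof.
move=> b0 mg gE mE; rewrite /lebesgue_measure2 /product_measure1.
have mgE : measurable (g @^-1` E) by rewrite -[_ @^-1` _]setTI; exact: mg.
rewrite -ge0_integralZl//; last exact: measurable_fun_xsection.
apply: eq_integral => x _ /=.
rewrite [LHS](@lebesgue_measure_affine b (h x))//; last exact: measurable_xsection.
congr (_ * leb _)%E; apply/seteqP; split=> y; rewrite /xsection /affine /= !inE /= gE//.
Qed.

Lemma lebesgue_measure2_xaffine (b : R) (g : X -> X) (h : R -> R)
    (E : set X) : b != 0 -> measurable_fun setT g ->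
  (forall p, g p = (b * p.1 + h p.2, p.2)) -> measurable E ->
  (lebesgue_measure2 E = (`|b|)%:E * lebesgue_measure2 (g @^-1` E))%E.
Proof.
move=> b0 mg gE mE.
have mgE : measurable (g @^-1` E) by rewrite -[_ @^-1` _]setTI; exact: mg.
rewrite !lebesgue_measure2_ysection// /product_measure2.
rewrite -ge0_integralZl//; last exact: measurable_fun_ysection.
apply: eq_integral => x _ /=.
rewrite [LHS](@lebesgue_measure_affine b (h x))//; last exact: measurable_ysection.
congr (_ * leb _)%E; apply/seteqP; split=> y; rewrite /ysection /affine /= !inE /= gE//.
Qed.

(* Conversion tests between measures of distinct sets otherwise unfold the product
   measure. *)
Local Opaque lebesgue_measure2.

Implicit Types (M N : 'M[R]_2) (p q a : X) (E : set X).

Definition lact M p : X :=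
  (M 0 0 * p.1 + M 0 1 * p.2, M 1 0 * p.1 + M 1 1 * p.2).

Lemma sum_ord2 (V : nmodType) (F : 'I_2 -> V) : \sum_i F i = F 0 + F 1.
Proof.
rewrite !big_ord_recl big_ord0 addr0.
by congr (_ + F _); apply: val_inj.
Qed.

Lemma ord2P (P : 'I_2 -> Prop) : P 0 -> P 1 -> forall i, P i.
Proof.
move=> P0 P1 [[|[|//]] h].
  by rewrite (_ : Ordinal h = 0) //; exact: val_inj.
by rewrite (_ : Ordinal h = 1) //; exact: val_inj.
Qed.

Lemma det2E (K : comNzRingType) (A : 'M[K]_2) :
  \det A = A 0 0 * A 1 1 - A 0 1 * A 1 0.
Proof.
rewrite (expand_det_row _ 0) !big_ord_recl big_ord0 addr0 /cofactor.
rewrite !det_mx11 !mxE /= /bump /= expr0 mul1r expr1 mulN1r mulrN.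
have e0 : lift 0 0 = 1 :> 'I_2 by exact: val_inj.
have e1 : lift (lift ord0 (0 : 'I_1)) 0 = 0 :> 'I_2 by exact: val_inj.
by rewrite e1 e0.
Qed.

Lemma lact1 p : lact 1 p = p.
Proof. by case: p => x y; rewrite /lact !mxE /= !mul1r !mul0r addr0 add0r. Qed.

Lemma lactM M N p : lact (M * N) p = lact M (lact N p).
Proof.
by case: p => x y; rewrite /lact -mulmxE !mxE !sum_ord2 /=; congr pair; ring.
Qed.

Lemma lactD M p q : lact M (p + q) = lact M p + lact M q.
Proof.
case: p q => [x y] [z t]; apply/pair_equal_spec; rewrite /lact /=.
by split; ring.
Qed.

Lemma measurable_lact M : measurable_fun setT (lact M).
Proof.
by apply: measurable_fun_pair; apply: measurable_funD;
  apply: measurable_funM.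
Qed.

Lemma measurable_lact_preimage M E :
  measurable E -> measurable (lact M @^-1` E).
Proof. by move=> mE; rewrite -[_ @^-1` _]setTI; exact: measurable_lact. Qed.

(** A matrix with nonzero corner entry factors into two maps that each change one coordinate, [g]
    and then [g']. *)
Lemma lebesgue_measure2_lact M E : M \in unitmx -> measurable E ->
  (lebesgue_measure2 E = `|\det M|%:E * lebesgue_measure2 (lact M @^-1` E))%E.
Proof.
rewrite unitmxE unitfE.
wlog M00 : M / M 0 0 != 0 => [wlg|] detM mE.
  have [M00|] := eqVneq (M 0 0) 0; last by move=> ?; exact: wlg.
  (* Multiplying by this shear adds the second column of [M] to the first. It preserves the
     determinant and puts [M 0 1] in the corner. *)
  pose N : 'M[R]_2 := \matrix_(i, j) ((i == j) || (i == 1))%:R.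
  have detN : \det N = 1 by rewrite det2E !mxE /=; ring.
  have detMN : \det (M * N) = \det M by rewrite -mulmxE det_mulmx detN mulr1.
  have M01 : M 0 1 != 0.
    apply: contra_neq detM => M01; by rewrite det2E M00 M01 !mul0r subr0.
  have MN00 : (M * N) 0 0 != 0.
    by rewrite -mulmxE !mxE sum_ord2 !mxE /= M00 mul0r add0r mulr1.
  have detMN0 : \det (M * N) != 0 by rewrite detMN.
  rewrite (wlg _ MN00 detMN0 mE) detMN; congr (_ * _)%E.
  have NE p : lact N p = (p.1, 1 * p.2 + p.1).
    by rewrite /lact !mxE /=; congr pair; ring.
  rewrite (lebesgue_measure2_yaffine (h := id) (oner_neq0 _)
    (@measurable_lact N) NE (measurable_lact_preimage M mE)).
  rewrite normr1 mul1e; congr (lebesgue_measure2 _).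
  by apply/seteqP; split=> p /=; rewrite lactM.
have detE := det2E M.
pose g p : X := (M 0 0 * p.1 + M 0 1 * p.2, p.2).
pose g' p : X := (p.1, \det M / M 0 0 * p.2 + M 1 0 / M 0 0 * p.1).
have mg : measurable_fun setT g.
  by apply: measurable_fun_pair => //; apply: measurable_funD => //;
    apply: measurable_funM.
have mg' : measurable_fun setT g'.
  by apply: measurable_fun_pair => //; apply: measurable_funD => //;
    apply: measurable_funM.
have gg' p : lact M p = g' (g p).
  by rewrite /g /g' /lact /= detE; congr pair; field.
have mg'E : measurable (g' @^-1` E) by rewrite -[_ @^-1` _]setTI; exact: mg'.
have dM0 : \det M / M 0 0 != 0 by rewrite mulf_neq0 ?invr_eq0.
have g'E p : g' p = (p.1, \det M / M 0 0 * p.2 + M 1 0 / M 0 0 * p.1) by [].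
have gE p : g p = (M 0 0 * p.1 + M 0 1 * p.2, p.2) by [].
rewrite (lebesgue_measure2_yaffine (h := *%R (M 1 0 / M 0 0)) dM0 mg' g'E mE).
rewrite (lebesgue_measure2_xaffine (h := *%R (M 0 1)) M00 mg gE mg'E).
rewrite muleA -EFinM -normrM divfK; last exact: M00.
congr (_ * lebesgue_measure2 _)%E.
by apply/seteqP; split=> p /=; rewrite gg'.
Qed.

Lemma measurable_translation a : measurable_fun setT (fun p => p + a).
Proof.
by apply: measurable_fun_pair; apply: measurable_funD.
Qed.

Lemma lebesgue_measure2_translation a E : measurable E ->
  lebesgue_measure2 ((fun p => p + a) @^-1` E) = lebesgue_measure2 E.
Proof.
move=> mE; pose g p : X := (p.1 + a.1, p.2); pose g' p : X := (p.1, p.2 + a.2).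
have mg : measurable_fun setT g.
  by apply: measurable_fun_pair => //; apply: measurable_funD.
have mg' : measurable_fun setT g'.
  by apply: measurable_fun_pair => //; apply: measurable_funD.
have mg'E : measurable (g' @^-1` E) by rewrite -[_ @^-1` _]setTI; exact: mg'.
have g'E p : g' p = (p.1, 1 * p.2 + a.2) by rewrite mul1r.
have gE p : g p = (1 * p.1 + a.1, p.2) by rewrite mul1r.
have := lebesgue_measure2_yaffine (h := fun=> a.2) (oner_neq0 _) mg' g'E mE.
rewrite (lebesgue_measure2_xaffine (h := fun=> a.1) (oner_neq0 _) mg gE mg'E).
by rewrite normr1 !mul1e => ->.
Qed.

End Plane.

(** * Negligible sets under countable actions *)

Section Negligible.
Context {d : measure_display} {X : measurableType d} {R : realType} {I : zmodType}.
Hypothesis countI : countable [set: I].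
Variables (mu : {measure set X -> \bar R}) (phi : I -> X -> X).
Hypothesis mphi : maction phi.
Hypothesis phi0 : forall i (S : set X), measurable S -> mu S = 0 ->
  mu (phi i @^-1` S) = 0.

Lemma countable_negligible_bigcup (F : I -> set X) :
  (forall i, mu.-negligible (F i)) -> mu.-negligible (\bigcup_i F i).
Proof.
move=> nF; have [e [e_surj _]] := countable_enum countI.
apply: (@negligibleS _ _ _ _ (\bigcup_n if e n is Some i then F i else set0)).
  by move=> x [i _ Fi]; have [n en] := e_surj i; exists n => //; rewrite en.
by apply: negligible_bigcup => n; case: (e n) => // ; exact: negligible_set0.
Qed.

Lemma negligible_sat (S : set X) :
  mu.-negligible S -> mu.-negligible (sat phi S).
Proof.
move=> [N [mN N0 SN]].
apply: (@negligibleS _ _ _ _ (\bigcup_i (phi i @^-1` N))).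
  by move=> x [i /SN Ni]; exists i.
apply: countable_negligible_bigcup => i; exists (phi i @^-1` N); split=> //.
  exact: measurable_act_preimage.
exact: phi0.
Qed.

(** Its removal turns a set that packs up to null sets into one that packs exactly. *)
Definition overlap (S : set X) : set X :=
  S `&` \bigcup_(i in [set i | i != 0]) (phi i @^-1` S).

Lemma measurable_overlap (S : set X) : measurable S -> measurable (overlap S).
Proof.
move=> mS; apply: measurableI => //; rewrite bigcup_mkcond.
apply: countable_bigcupT_measurable => // i.
by case: ifP => // _; exact: measurable_act_preimage.
Qed.

Lemma packing_setD_overlap (S : set X) : packing phi (S `\` overlap S).
Proof.
move=> i x [Sx nx] [Si _]; apply/eqP; apply: contrapT => /negP i0.
by apply: nx; split=> //; exists i.
Qed.

Lemma negligible_overlap (S : set X) :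
  (forall i, i != 0 -> mu.-negligible (S `&` phi i @^-1` S)) ->
  mu.-negligible (overlap S).
Proof.
move=> nS; apply: (@negligibleS _ _ _ _
    (\bigcup_i if i == 0 then set0 else S `&` phi i @^-1` S)).
  by move=> x [Sx [i /= i0 Si]]; exists i => //; rewrite (negbTE i0).
apply: countable_negligible_bigcup => i.
by case: (eqVneq i 0) => [_|i0]; [exact: negligible_set0|exact: nS].
Qed.

(** An orbit that meets [S] but not [S'] lies in the saturation of the null set [S \ S']. *)
Lemma negligible_sat_setC (S S' : set X) : mu.-negligible (S `\` S') ->
  mu.-negligible (~` sat phi S) -> mu.-negligible (~` sat phi S').
Proof.
move=> nSS' nS.
apply: (@negligibleS _ _ _ _ (~` sat phi S `|` sat phi (S `\` S'))).
  move=> x nx; have [[i Si]|] := pselect (sat phi S x); last by left.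
  by right; exists i; split=> // ?; apply: nx; exists i.
by apply: negligibleU => //; exact: negligible_sat.
Qed.

End Negligible.

(** * Wavelet sets as common fundamental domains *)

Section Plane_actions.
Context {R : realType}.
Notation X := (measurableTypeR R * measurableTypeR R)%type.
Notation mu := (@lebesgue_measure2 R).
Implicit Types (p q : X) (E S : set X) (B : 'M[R]_2) (a : int * int) (n : int).

Definition lattice_pt a : X := (a.1%:~R, a.2%:~R).

Definition tau a p : X := p + lattice_pt a.

Definition beta B n p : X := lact (B ^ n) p.

Lemma lattice_ptD a b : lattice_pt (a + b) = lattice_pt a + lattice_pt b.
Proof. by apply/pair_equal_spec; rewrite /= !intrD. Qed.

Lemma lattice_pt0 : lattice_pt 0 = 0.
Proof. by apply/pair_equal_spec; rewrite /=; split. Qed.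

Lemma countable_int : countable [set: int].
Proof. exact: countableP. Qed.

Lemma countable_int2 : countable [set: int * int].
Proof. exact: countableP. Qed.

Lemma maction_tau : maction tau.
Proof.
split; last by move=> a; exact: measurable_translation.
split=> [p|a b p]; first by rewrite /tau lattice_pt0 addr0.
by rewrite /tau lattice_ptD (addrC (lattice_pt a)) addrA.
Qed.

Lemma maction_beta B : B \in unitmx -> maction (beta B).
Proof.
move=> uB; split; last by move=> n; exact: measurable_lact.
split=> [p|m n p]; first by rewrite /beta expr0z lact1.
by rewrite /beta -lactM exprzDr.
Qed.

Lemma mu_tau a S : measurable S -> mu (tau a @^-1` S) = mu S.
Proof. exact: lebesgue_measure2_translation. Qed.

Lemma exprz_unitmx B n : B \in unitmx -> B ^ n \in unitmx.
Proof. exact: unitrXz. Qed.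

Lemma det_exprz B n : \det (B ^ n) = \det B ^ n.
Proof.
have detX m : \det (B ^+ m) = \det B ^+ m.
  by elim: m => [|m IH]; rewrite ?expr0 ?det1// !exprS -mulmxE det_mulmx IH.
case: n => n; first exact: detX.
by rewrite /exprz det_inv detX.
Qed.

Lemma normr_exprz (x : R) n : `|x ^ n| = `|x| ^ n.
Proof. by case: n => n; rewrite /exprz ?normfV normrX. Qed.

Lemma mu_beta B n S : B \in unitmx -> measurable S ->
  mu S = ((`|\det B| ^ n)%:E * mu (beta B n @^-1` S))%E.
Proof.
move=> uB mS; rewrite (lebesgue_measure2_lact (exprz_unitmx n uB) mS).
by rewrite det_exprz normr_exprz.
Qed.

Lemma mu_lact_eq0 B S : B \in unitmx -> measurable S ->
  mu S = 0 -> mu (lact B @^-1` S) = 0.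
Proof.
move=> uB mS; rewrite (lebesgue_measure2_lact uB mS) => /eqP.
rewrite mule_eq0 eqe normr_eq0 => /orP[/eqP d0|/eqP//].
by move: uB; rewrite unitmxE d0 unitr0.
Qed.

Definition uncoords p : 'cV[R]_2 := \col_i (if i == 0 then p.1 else p.2).

Lemma uncoordsK : cancel uncoords (@coords R).
Proof. by case=> x y; rewrite /coords !mxE. Qed.

Lemma coordsK : cancel (@coords R) uncoords.
Proof. by move=> x; apply/colP; apply: ord2P; rewrite !mxE. Qed.

Lemma coords_image (T : set 'cV[R]_2) : @coords R @` T = uncoords @^-1` T.
Proof.
apply/seteqP; split=> [_ [x Tx <-]|p Tp]; first by rewrite /= coordsK.
by exists (uncoords p) => //; rewrite uncoordsK.
Qed.

Lemma uncoords_lact B p : uncoords (lact B p) = B *m uncoords p.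
Proof. by apply/colP; apply: ord2P; rewrite !mxE sum_ord2 !mxE. Qed.

Lemma image_translation (T : set 'cV[R]_2) (v : 'cV[R]_2) :
  [set x + v | x in T] = [set x | T (x - v)].
Proof.
apply/seteqP; split=> [_ [x Tx <-]|x Tx]; first by rewrite /= addrK.
by exists (x - v) => //; rewrite subrK.
Qed.

Lemma image_exprz (T : set 'cV[R]_2) B n : B \in unitmx ->
  [set B ^ n *m x | x in T] = [set x | T (B ^ (- n) *m x)].
Proof.
move=> uB; have BnK m : B ^ m *m B ^ (- m) = 1%:M.
  by rewrite mulmxE -exprzDr// subrr.
apply/seteqP; split=> [_ [x Tx <-]|x Tx].
  by rewrite /= mulmxA -{2}(opprK n) BnK mul1mx.
by exists (B ^ (- n) *m x) => //; rewrite mulmxA BnK mul1mx.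
Qed.

Lemma uncoords_tau a p : uncoords (tau a p) = uncoords p + uncoords (lattice_pt a).
Proof. by apply/colP; apply: ord2P; rewrite !mxE. Qed.

Lemma integer_latticeP (v : 'cV[R]_2) :
  integer_lattice v <-> exists a, v = uncoords (lattice_pt a).
Proof.
split=> [vi|[a -> i]]; last first.
  by rewrite !mxE; case: ifP => _; exact: intr_int.
have /intrP[m vm] := vi 0; have /intrP[n vn] := vi 1.
by exists (m, n); apply/colP; apply: ord2P; rewrite !mxE.
Qed.

Lemma lattice_pt_inj : injective lattice_pt.
Proof. by move=> [a b] [c e] [] /intr_inj -> /intr_inj ->. Qed.

Lemma lattice_ptN a : lattice_pt (- a) = - lattice_pt a.
Proof. by apply/pair_equal_spec; rewrite /= !mulrNz. Qed.

Lemma uncoordsN p : uncoords (- p) = - uncoords p.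
Proof. by apply/colP; apply: ord2P; rewrite !mxE. Qed.

Lemma uncoords_inj : injective uncoords.
Proof. exact: can_inj uncoordsK. Qed.

Lemma measurable2_preimage (T : set 'cV[R]_2) :
  measurable (uncoords @^-1` T) -> measurable2 T.
Proof.
move=> mT; rewrite /measurable2 coords_image; exists (uncoords @^-1` T) => //.
by exists set0; [exact: negligible_set0|rewrite setU0].
Qed.

Lemma null2E (T : set 'cV[R]_2) : null2 T = mu.-negligible (uncoords @^-1` T).
Proof. by rewrite /null2 coords_image. Qed.

Lemma tau_null a S : measurable S -> mu S = 0 -> mu (tau a @^-1` S) = 0.
Proof. by move=> mS S0; rewrite mu_tau. Qed.

Lemma beta_null B n S : B \in unitmx -> measurable S -> mu S = 0 ->
  mu (beta B n @^-1` S) = 0.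
Proof. by move=> uB; apply: mu_lact_eq0; exact: exprz_unitmx. Qed.

(** A normal form for wavelet sets: measurable for the product sigma-algebra itself, exactly
    packing, and covering almost everywhere. *)
Definition double_tile B E := [/\ measurable E, packing tau E, packing (beta B) E,
  mu.-negligible (~` sat tau E) & mu.-negligible (~` sat (beta B) E)].

Lemma double_tile_wavelet_set (A : 'M[R]_2) E : A^T \in unitmx ->
  double_tile A^T E -> wavelet_set A (@coords R @^-1` E).
Proof.
move=> uA [mE pE qE tE bE]; set T := _ @^-1` E.
have TE p : T (uncoords p) = E p by rewrite /T /= uncoordsK.
have mT : measurable2 T.
  by apply: measurable2_preimage; rewrite (_ : _ @^-1` _ = E)//; apply/funext.
have trE a : uncoords @^-1` [set x + uncoords (lattice_pt a) | x in T]
    = tau (- a) @^-1` E.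
  rewrite image_translation; apply/funext => p /=.
  by rewrite -uncoordsN -lattice_ptN -uncoords_tau TE.
have beE n : uncoords @^-1` [set A^T ^ n *m x | x in T] = beta A^T (- n) @^-1` E.
  rewrite image_exprz//; apply/funext => p /=.
  by rewrite -uncoords_lact TE.
split; split=> //; split.
- move=> _ /integer_latticeP[a ->]; apply: measurable2_preimage.
  by rewrite trE; apply: measurable_act_preimage => //; exact: maction_tau.
- move=> _ _ /integer_latticeP[a ->] /integer_latticeP[b ->] ab.
  rewrite null2E preimage_setI !trE (_ : _ `&` _ = set0).
    exact: negligible_set0.
  apply/seteqP; split=> // p [Ea Eb]; apply: ab; congr (uncoords (lattice_pt _)).
  have := pE (a - b) _ Ea; rewrite -(actD maction_tau) addrAC subrr add0r.
  by move=> /(_ Eb)/eqP; rewrite subr_eq0 => /eqP.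
- rewrite null2E; apply: negligibleS tE => p np -[a Ea]; apply: np.
  exists (uncoords (lattice_pt (- a))); first by apply/integer_latticeP; exists (- a).
  have : (uncoords @^-1` [set x + uncoords (lattice_pt (- a)) | x in T]) p.
    by rewrite trE opprK.
  by [].
- move=> n _; apply: measurable2_preimage.
  by rewrite beE; apply: measurable_act_preimage => //; exact: maction_beta.
- move=> n m _ _ nm.
  rewrite null2E preimage_setI !beE (_ : _ `&` _ = set0).
    exact: negligible_set0.
  apply/seteqP; split=> // p [Ea Eb]; apply: nm.
  have := qE (n - m) _ Ea; rewrite -(actD (maction_beta uA)) addrAC subrr add0r.
  by move=> /(_ Eb)/eqP; rewrite subr_eq0 => /eqP.
- rewrite null2E; apply: negligibleS bE => p np -[a Ea]; apply: np.
  exists (- a) => //.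
  have : (uncoords @^-1` [set A^T ^ (- a) *m x | x in T]) p.
    by rewrite beE opprK.
  by [].
Qed.

(** A Lebesgue measurable set is a set [E0] of the product sigma-algebra up to a null set; the
    tiling conditions make both overlaps of [E0] null, so they can be discarded. *)
Lemma wavelet_set_double_tile (A : 'M[R]_2) T : A^T \in unitmx ->
  wavelet_set A T -> exists E, double_tile A^T E.
Proof.
move=> uA [[mT [_ tT cT]] [_ [_ bT dT]]].
move: mT; rewrite /measurable2 coords_image => -[E0 mE0 [N nN E0N]].
have E0T p : E0 p -> T (uncoords p).
  by move=> E0p; have : (E0 `|` N) p by [left]; rewrite E0N.
have mbeta := maction_beta uA.
have ovt : mu.-negligible (overlap tau E0).
  apply: negligible_overlap; first exact: countable_int2.
  (* The translate by [- a] is the one to compare with [T], being the preimage of [T] under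
     [tau a]. *)
  move=> a a0; have L0 : integer_lattice (0 : 'cV[R]_2).
    by move=> i; rewrite mxE; exact: rpred0.
  have La : integer_lattice (uncoords (lattice_pt (- a))).
    by apply/integer_latticeP; exists (- a).
  have ne : 0 <> uncoords (lattice_pt (- a)).
    rewrite (_ : 0 = uncoords (lattice_pt 0)); last first.
      by rewrite lattice_pt0; apply/colP; apply: ord2P; rewrite !mxE.
    by move=> /uncoords_inj/lattice_pt_inj/esym/eqP; rewrite oppr_eq0 (negbTE a0).
  have := tT _ _ L0 La ne; rewrite null2E; apply: negligibleS => p [/E0T Ep /E0T Ea].
  rewrite !image_translation; split=> /=; first by rewrite subr0.
  by rewrite -uncoordsN -lattice_ptN opprK -uncoords_tau.
have ovb : mu.-negligible (overlap (beta A^T) E0).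
  apply: negligible_overlap; first exact: countable_int.
  move=> n n0; have ne : 0 <> - n.
    by move/esym/eqP; rewrite oppr_eq0 (negbTE n0).
  have := bT 0 (- n) I I ne; rewrite null2E; apply: negligibleS => p [/E0T Ep /E0T Ea].
  rewrite !image_exprz//; split=> /=; first by rewrite oppr0 expr0z mul1mx.
  by rewrite opprK -uncoords_lact.
have mov := measurable_overlap countable_int2 maction_tau mE0.
have mov' := measurable_overlap countable_int mbeta mE0.
pose E := E0 `\` (overlap tau E0 `|` overlap (beta A^T) E0).
have nTE : mu.-negligible ((uncoords @^-1` T) `\` E).
  apply: (@negligibleS _ _ _ _ (N `|` (overlap tau E0 `|` overlap (beta A^T) E0))).
    rewrite -E0N => p [[E0p|Np] nE]; last by left.
    by right; apply: contrapT => h; exact: nE.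
  by apply: negligibleU => //; exact: negligibleU.
exists E; split.
- by apply: measurableD => //; exact: measurableU.
- apply: (packingS _ (@packing_setD_overlap _ _ _ tau E0)).
  by move=> p [E0p h]; split=> // ?; apply: h; left.
- apply: (packingS _ (@packing_setD_overlap _ _ _ (beta A^T) E0)).
  by move=> p [E0p h]; split=> // ?; apply: h; right.
- apply: (negligible_sat_setC countable_int2 maction_tau _ nTE).
    exact: tau_null.
  move: cT; rewrite null2E; apply: negligibleS => p np -[x /integer_latticeP[a ->]].
  rewrite image_translation /= => Tp; apply: np; exists (- a).
  by rewrite /= uncoords_tau lattice_ptN uncoordsN.
- apply: (negligible_sat_setC countable_int mbeta _ nTE).
    by move=> n S; exact: beta_null.
  move: dT; rewrite null2E; apply: negligibleS => p np -[n _].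
  rewrite image_exprz//= => Tp; apply: np; exists (- n).
  by rewrite /= uncoords_lact.
Qed.

End Plane_actions.

(** * A fundamental domain of the dilation that packs for the lattice *)

Section Tiles.
Context {R : realType}.
Notation X := (measurableTypeR R * measurableTypeR R)%type.
Notation mu := (@lebesgue_measure2 R).
Implicit Types (p q : X) (E S : set X) (n : int).

Definition unit_itv (u : R) : set (measurableTypeR R) := [set` `[u, u + 1[%R].

Definition unit_box (u v : R) : set X := unit_itv u `*` unit_itv v.

Lemma measurable_unit_box u v : measurable (unit_box u v).
Proof. by apply: measurableX; exact: measurable_itv. Qed.

Lemma mu_unit_box u v : mu (unit_box u v) = 1%E.
Proof.
have -> : mu (unit_box u v) = (@lebesgue_measure R (unit_itv u) *
    @lebesgue_measure R (unit_itv v))%E.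
  by apply: product_measure1E; exact: measurable_itv.
rewrite !lebesgue_measure_itv /= !lte_fin !ltrDl ltr01 -!EFinD.
by rewrite !(addrC _ 1) !addrK mule1.
Qed.

Lemma unit_boxP u v p : unit_box u v p <->
  (u <= p.1 < u + 1 /\ v <= p.2 < v + 1).
Proof. by rewrite /unit_box /unit_itv /= !in_itv. Qed.

Lemma unit_box_diff u v p q : unit_box u v p -> unit_box u v q ->
  `|q.1 - p.1| < 1 /\ `|q.2 - p.2| < 1.
Proof.
move=> /unit_boxP[/andP[? ?] /andP[? ?]] /unit_boxP[/andP[? ?] /andP[? ?]].
by rewrite !ltr_norml; split; apply/andP; split; lra.
Qed.

Lemma unit_box_floor p : unit_box (Num.floor p.1)%:~R (Num.floor p.2)%:~R p.
Proof.
have h (x : R) : (Num.floor x)%:~R <= x < (Num.floor x)%:~R + 1.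
  by have := floor_itv x; rewrite intrD.
by apply/unit_boxP; split; exact: h.
Qed.

Lemma small_int (z : int) : `|z%:~R : R| < 1 -> z = 0.
Proof. by rewrite -intr_norm ltrz1; lia. Qed.

Lemma packing_tau_unit_box u v : packing tau (unit_box u v).
Proof.
move=> [a b] p pB qB; have [] := unit_box_diff pB qB.
by rewrite /tau /= !(addrC _ (_%:~R)) !addrK => /small_int-> /small_int->.
Qed.

Lemma sat_tau_unit_box u v : sat tau (unit_box u v) = setT.
Proof.
apply/seteqP; split=> // p _.
exists (- Num.floor (p.1 - u), - Num.floor (p.2 - v)).
have /unit_boxP[/= /andP[? ?] /andP[? ?]] := unit_box_floor (p.1 - u, p.2 - v).
by apply/unit_boxP; split; rewrite /= mulrNz; apply/andP; split; lra.
Qed.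

(** The witness is [m.+1 = 2 ^ e * (2 * N + 1)]. Reading off this valuation gives a sequence that
    takes each value infinitely often. *)
Lemma logn_often (e N : nat) : exists2 m, (N <= m)%N & logn 2 m.+1 = e.
Proof.
exists ((2 ^ e * (2 * N).+1).-1).
  have : (0 < 2 ^ e)%N by rewrite expn_gt0.
  by nia.
rewrite prednK ?muln_gt0 ?expn_gt0// lognM ?expn_gt0// pfactorK//.
by rewrite lognE dvdn2 /= mul2n odd_double /= addn0.
Qed.

Lemma geometric_tail (r : R) (N : nat) : 0 <= r -> r < 1 ->
  (\sum_(N <= n <oo) (r ^+ n)%:E <= (r ^+ N / (1 - r))%:E)%E.
Proof.
move=> r0 r1; apply: lime_le.
  by apply: is_cvg_nneseries => n _ _; rewrite lee_fin exprn_ge0.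
apply: nearW => n; rewrite sumEFin lee_fin ler_pdivlMr ?subr_gt0//.
have [nN|Nn] := leqP n N; first by rewrite big_geq// mul0r exprn_ge0.
suff -> : (\sum_(N <= i < n) r ^+ i) * (1 - r) = r ^+ N - r ^+ n.
  by rewrite lerBlDr lerDl exprn_ge0.
rewrite big_distrl /= (eq_bigr (fun i => - r ^+ i.+1 - - r ^+ i)).
  by rewrite telescope_sumr ?(ltnW Nn)// opprK addrC.
by move=> i _; rewrite exprSr; ring.
Qed.

Lemma tau_beta (B : 'M[R]_2) n a p :
  beta B n (tau a p) = beta B n p + beta B n (lattice_pt a).
Proof. exact: lactD. Qed.

Section Packing_cover.
Variable (B : 'M[R]_2).
Hypotheses (uB : B \in unitmx) (detB : 1 < `|\det B|).

Let mbeta := maction_beta uB.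

(** The open square of side 2 is the difference set of a half-open unit box, so for such [j] the
    pullback of any unit box by [B ^ j] packs modulo the lattice. *)
Definition lattice_free (j : nat) := forall a,
  `|(beta B j (lattice_pt a)).1| < 1 -> `|(beta B j (lattice_pt a)).2| < 1 ->
  a = 0.

Lemma packing_tau_beta_unit_box (j : nat) u v : lattice_free j ->
  packing tau (beta B j @^-1` unit_box u v).
Proof.
move=> fj a p pB qB; have [] := unit_box_diff pB qB.
have sub1 (x y : X) : (x + y).1 - x.1 = y.1 by rewrite addrC addKr.
have sub2 (x y : X) : (x + y).2 - x.2 = y.2 by rewrite addrC addKr.
by rewrite tau_beta sub1 sub2; exact: fj.
Qed.

Hypothesis freeB : forall N, exists2 j, (N <= j)%N & lattice_free j.

(* The exponents [j m] grow so fast that, after rescaling by [B ^ j m], the sets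
   [beta B (j m') @^-1` box] with [m' > m] have a total measure tending to [0]:
   discarding from each of these sets its overlap modulo Z^2 with the later ones
   loses only a null set in the end, because each box recurs infinitely often. *)
Lemma packing_cover : exists2 G : set X, measurable G /\ packing tau G &
  mu.-negligible (~` sat (beta B) G).
Proof.
pose g N := projT1 (cid2 (freeB N)).
have gN N : (N <= g N)%N /\ lattice_free (g N).
  by rewrite /g; case: cid2.
(* The gap of [m.+1] gives [j m + i <= j i] for [m < i]. Rescaled by [B ^ j m], the overlap of stage
   [m] with stage [i] then has measure at most [r ^+ i]. *)
pose j := fix j m := if m is m'.+1 then g (j m' + m'.+1)%N else g 0.
have jfree m : lattice_free (j m) by case: m => [|m]; exact: (gN _).2.
have jS m : (j m + m.+1 <= j m.+1)%N by exact: (gN _).1.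
have jlt m m' : (m < m')%N -> (j m + m' <= j m')%N.
  elim: m' => // m' IH; rewrite ltnS leq_eqVlt => /orP[/eqP<-//|/IH h].
  by have := jS m'; lia.
(* The 2-adic valuation of [m.+1] encodes the box treated at stage [m], so every box recurs; the
   default serves valuations that encode no box. *)
pose k m : int * int := odflt (0, 0) (unpickle (logn 2 m.+1)).
have kinf c N : exists2 m, (N <= m)%N & k m = c.
  have [m Nm lm] := logn_often (pickle c) N.
  by exists m; rewrite // /k lm pickleK.
pose V (c : int * int) := unit_box (c.1%:~R) (c.2%:~R).
pose S m := beta B (j m) @^-1` V (k m).
have mV c : measurable (V c) by exact: measurable_unit_box.
have mS m : measurable (S m) by exact: measurable_act_preimage.
pose D := `|\det B|; have D0 : 0 < D by exact: lt_trans detB.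
pose r := D^-1; have r0 : 0 <= r by rewrite invr_ge0 ltW.
have r1 : r < 1 by rewrite invf_lt1.
have muS m : mu (S m) = (r ^+ j m)%:E.
  have := mu_unit_box (k m).1%:~R (k m).2%:~R.
  rewrite (mu_beta (j m) uB (mV (k m))) -/(S m) -/D => h.
  have Dj : D ^+ j m != 0 by rewrite expf_neq0// gt_eqF.
  rewrite -[LHS]mul1e -(mulVf Dj) EFinM -muleA h mule1.
  by rewrite -exprVn.
pose G m := S m `\` \bigcup_(i in ~` `I_m.+1) sat tau (S i).
have mtS i : measurable (sat tau (S i)).
  by apply: measurable_sat => //; [exact: countable_int2|exact: maction_tau].
have mG m : measurable (G m).
  by apply: measurableD => //; exact: bigcup_measurable.
exists (\bigcup_m G m); first split.
- exact: bigcupT_measurable.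
- move=> a p [m _ [Sm nm]] [m' _ [Sm' nm']]; have [h|h|h] := ltngtP m m'.
  + by case: nm; exists m' => /=; [rewrite ltnS leqNgt h|exists a].
  + case: nm'; exists m => /=; first by rewrite ltnS leqNgt h.
    by exists (- a); rewrite (actK maction_tau).
  + by subst m'; apply: (packing_tau_beta_unit_box _ Sm Sm').
(* [Z c] is what no stage recovers of the box at [c]. Each stage for [c] bounds its measure by a
   geometric tail, and such stages occur arbitrarily late. *)
pose Z c := V c `\` \bigcup_(m in [set m | k m = c]) (beta B (- (j m)%:Z) @^-1` G m).
have mZ c : measurable (Z c).
  apply: measurableD => //; apply: bigcup_measurable => m _.
  exact: measurable_act_preimage.
have Z0 c : mu (Z c) = 0.
  have Zle m : k m = c -> (mu (Z c) <= (r ^+ m / (1 - r))%:E)%E.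
    move=> km; pose F i := beta B (- (j m)%:Z) @^-1` (S m `&` sat tau (S i)).
    have mF i : measurable (F i).
      by apply: measurable_act_preimage => //; exact: measurableI.
    have ZF : Z c `<=` \bigcup_(i in ~` `I_m.+1) F i.
      move=> p [Vp nGp]; apply: contrapT => nF; apply: nGp; exists m => //.
      have Sp : S m (beta B (- (j m)%:Z) p).
        by rewrite /S /= (actVK mbeta) km.
      by split=> // -[i mi Si]; apply: nF; exists i.
    apply: le_trans (measure_sigma_subadditive_tail _ mF (mZ c) ZF) _.
    apply: (@le_trans _ _ (\sum_(m.+1 <= n <oo) (r ^+ n)%:E)%E).
      rewrite eseries_cond [leRHS]eseries_cond.
      apply: lee_nneseries => [i _ _|i /= mi]; first exact: measure_ge0.
      have : (mu (S m `&` sat tau (S i)) <= (r ^+ j i)%:E)%E.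
        rewrite -muS; apply: packing_le_sat => //.
        * exact: countable_int2.
        * exact: maction_tau.
        * by move=> a E; exact: mu_tau.
        * exact: packing_tau_beta_unit_box.
      have mSS : measurable (S m `&` sat tau (S i)) by exact: measurableI.
      rewrite (mu_beta (- (j m)%:Z) uB mSS) -/(F i) -/D -exprnN -exprVn => h.
      have rj : 0 < r ^+ j m by rewrite exprn_gt0// invr_gt0.
      rewrite -(lee_pmul2l (x := (r ^+ j m)%:E))//.
      apply: (le_trans h); rewrite -EFinM lee_fin -exprD.
      apply: ler_wiXn2l => //; first exact: ltW.
      exact: jlt.
    apply: (le_trans (geometric_tail _ r0 r1)); rewrite lee_fin.
    rewrite ler_pM2r ?invr_gt0 ?subr_gt0//.
    by apply: ler_wiXn2l => //; exact: ltW.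
  apply/eqP; rewrite eq_le measure_ge0 andbT; apply/lee_addgt0Pr => e e0.
  have : (fun m => r ^+ m / (1 - r)) @ \oo --> (0 : R).
    rewrite -[X in _ --> X](mul0r (1 - r)^-1); apply: cvgMl.
    by apply: cvg_expr; rewrite ger0_norm.
  move=> /cvgr0Pnorm_lt /(_ _ e0)[N _ hN].
  have [m Nm km] := kinf c N; rewrite add0e.
  apply: (le_trans (Zle m km)); rewrite lee_fin ltW//.
  by apply: le_lt_trans (ler_norm _) _; exact: hN.
apply: (@negligibleS _ _ _ _ (\bigcup_c Z c)).
  move=> p np; exists (Num.floor p.1, Num.floor p.2) => //; split.
    exact: unit_box_floor.
  by move=> [m _ Gp]; apply: np; exists (- (j m)%:Z); exists m.
apply: (countable_negligible_bigcup countable_int2) => c.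
apply/negligibleP; first exact: mZ.
exact: Z0.
Qed.

Variable W : nat -> set X.
Hypotheses (mW : forall i, measurable (W i))
  (pW : forall i, packing (beta B) (W i))
  (coverW : mu.-negligible (~` \bigcup_i W i)).

(** [packing_selection] thins [G] to one point per orbit. Only orbits meeting the null complement of
    the [W i], or missing [G], can be lost. *)
Lemma dilation_tile_packing : exists P : set X,
  [/\ measurable P, packing tau P, packing (beta B) P &
      mu.-negligible (~` sat (beta B) P)].
Proof.
have [G [mG pG] nG] := packing_cover.
have [P [PG mP pP GP]] := packing_selection countable_int mbeta mG mW pW.
exists P; split=> //; first exact: packingS pG.
apply: (@negligibleS _ _ _ _ (~` sat (beta B) G `|` sat (beta B) (~` \bigcup_i W i))).
  move=> p np; have [[n Gn]|] := pselect (sat (beta B) G p); last by left.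
  right; exists n => -[i _ Wi]; apply: np.
  by apply: (sat_act mbeta (i := n)); exact: (GP i).
apply: negligibleU => //; apply: negligible_sat => //; first exact: countable_int.
by move=> n E; exact: beta_null.
Qed.

End Packing_cover.

End Tiles.

(** * Comparing measures of fundamental domains *)

Section Obstructions.
Context {R : realType}.
Notation X := (measurableTypeR R * measurableTypeR R)%type.
Notation mu := (@lebesgue_measure2 R).
Implicit Types (p q : X) (E S : set X) (n : int).

Lemma packing_le_cover (I : zmodType) (phi : I -> X -> X) E S :
  countable [set: I] -> maction phi ->
  (forall i S', measurable S' -> mu (phi i @^-1` S') = mu S') ->
  measurable E -> measurable S -> packing phi E ->
  mu.-negligible (~` sat phi S) -> (mu E <= mu S)%E.
Proof.
move=> cI mphi phi_mu mE mS pE nS.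
have msS : measurable (sat phi S) by exact: measurable_sat.
rewrite (measureDI _ mE msS) [X in (X + _)%E](_ : _ = 0%E).
  by rewrite add0e; exact: packing_le_sat.
apply/negligibleP; first exact: measurableD.
by apply: negligibleS nS => p [].
Qed.

(** The unit square is another fundamental domain of the lattice, and the comparison works in both
    directions. *)
Lemma double_tile_measure (B : 'M[R]_2) E : double_tile B E -> mu E = 1%E.
Proof.
move=> [mE pE _ tE _]; apply/eqP; rewrite eq_le -{1 2}(mu_unit_box 0 0).
have mB := measurable_unit_box (0 : R) 0.
have mtau a S (mS : measurable S) := mu_tau a mS.
apply/andP; split; apply: (packing_le_cover countable_int2 maction_tau mtau) => //.
  by rewrite sat_tau_unit_box setCT; exact: negligible_set0.
exact: packing_tau_unit_box.
Qed.

(* [E] and its dilate by 2 are both tiles of the measure preserving action of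
   [B], so they have the same measure. *)
Lemma no_double_tile_det1 (B : 'M[R]_2) E : B \in unitmx -> `|\det B| = 1 ->
  ~ double_tile B E.
Proof.
move=> uB det1 tE; have E1 := double_tile_measure tE.
have [mE _ qE _ bE] := tE; have mbeta := maction_beta uB.
have mbeta_mu n S : measurable S -> mu (beta B n @^-1` S) = mu S.
  by move=> mS; rewrite [RHS](mu_beta n uB mS) det1 exp1rz mul1e.
(* A scalar matrix commutes with [B], so the preimage of [E] still meets almost every orbit,
   although its measure is a quarter of that of [E]. *)
pose D : 'M[R]_2 := 2%:M.
have detD : \det D = 4 by rewrite det_scalar; ring.
have uD : D \in unitmx by rewrite unitmxE detD unitfE; lra.
pose E' := lact D @^-1` E.
have mE' : measurable E' by exact: measurable_lact_preimage.
have betaD n p : lact D (beta B n p) = beta B n (lact D p).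
  by rewrite /beta -!lactM; congr lact; rewrite -!mulmxE mul_scalar_mx mul_mx_scalar.
have le : (mu E <= mu E')%E.
  apply: (packing_le_cover countable_int mbeta mbeta_mu) => //.
  rewrite (_ : ~` sat (beta B) E' = lact D @^-1` (~` sat (beta B) E)).
    have [N [mN N0 sN]] := bE; exists (lact D @^-1` N); split.
    - exact: measurable_lact_preimage.
    - exact: mu_lact_eq0.
    - by move=> p /sN.
  apply/seteqP; split=> p np [n En]; apply: np; exists n.
    by rewrite /E' /= betaD.
  by rewrite -betaD.
have := lebesgue_measure2_lact uD mE; rewrite -/E' detD E1 => h.
move: le; rewrite E1 => le.
have : ((`|4 : R|)%:E * 1 <= `|4 : R|%:E * mu E')%E by apply: lee_wpmul2l.
by rewrite -h mule1 lee_fin ger0_norm; lra.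
Qed.

Lemma geometric_bigcup_finite (F : nat -> set X) (r f : R) :
  0 <= r -> r < 1 -> (forall k, measurable (F k)) ->
  (forall k, (mu (F k) <= (f * r ^+ k)%:E)%E) -> (mu (\bigcup_k F k) < +oo)%E.
Proof.
move=> r0 r1 mF Fr; apply: (le_lt_trans (generalized_Boole_inequality mu mF _)).
  exact: bigcupT_measurable.
apply: (@le_lt_trans _ _ (f%:E * \sum_(0 <= k <oo) (r ^+ k)%:E)%E).
  rewrite -nneseriesZl; last by move=> k _; rewrite lee_fin exprn_ge0.
  by apply: lee_nneseries => k; rewrite ?measure_ge0// => _; rewrite -EFinM Fr.
apply: lte_mul_pinfty => //.
  have := Fr 0; rewrite expr0 mulr1; apply: le_trans; exact: (measure_ge0 mu).
exact: le_lt_trans (geometric_tail 0 r0 r1) (ltry _).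
Qed.

End Obstructions.

(** * The dominant eigenform *)

Section Eigenform.
Local Open Scope complex_scope.
Context {R : realType}.
Notation X := (measurableTypeR R * measurableTypeR R)%type.
Notation mu := (@lebesgue_measure2 R).
Notation normc := (@Normc.normc R).
Implicit Types (p q : X) (E S : set X) (n : int).

(** Complete the form to an invertible matrix; the line is then the preimage of a coordinate
    axis. *)
Lemma line_null (u w : R) : (u != 0) || (w != 0) ->
  mu.-negligible [set p | u * p.1 + w * p.2 = 0].
Proof.
have mu0 (A B : set (measurableTypeR R)) : measurable A -> measurable B ->
    lebesgue_measure A = 0 \/ lebesgue_measure B = 0 -> mu (A `*` B) = 0.
  move=> mA mB AB.
  have -> : mu (A `*` B) = (lebesgue_measure A * lebesgue_measure B)%E.
    exact: product_measure1E.
  by case: AB => ->; rewrite ?mul0e ?mule0.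
have m1 := @measurable_set1 R 0.
move=> /orP[u0|w0].
- pose M : 'M[R]_2 := \matrix_(i, j)
    if i == 0 then (if j == 0 then u else w) else (j == 1)%:R.
  have uM : M \in unitmx by rewrite unitmxE det2E !mxE /= mulr0 subr0 mulr1 unitfE.
  exists (lact M @^-1` ([set 0] `*` setT)); split.
  + by apply: measurable_lact_preimage; exact: measurableX.
  + apply: mu_lact_eq0 => //; first exact: measurableX.
    by apply: mu0 => //; left; exact: lebesgue_measure_set1.
  + by move=> p /= h; split=> //=; rewrite !mxE.
- pose M : 'M[R]_2 := \matrix_(i, j)
    if i == 0 then (j == 0)%:R else (if j == 0 then u else w).
  have uM : M \in unitmx by rewrite unitmxE det2E !mxE /= mul0r subr0 mul1r unitfE.
  exists (lact M @^-1` (setT `*` [set 0])); split.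
  + by apply: measurable_lact_preimage; exact: measurableX.
  + apply: mu_lact_eq0 => //; first exact: measurableX.
    by apply: mu0 => //; right; exact: lebesgue_measure_set1.
  + by move=> p /= h; split=> //=; rewrite !mxE.
Qed.

Variables (B : 'M[R]_2) (l1 l2 a b : R[i]).
Hypotheses (uB : B \in unitmx) (trB : (B 0 0 + B 1 1)%:C = l1 + l2)
  (ab0 : (a != 0) || (b != 0))
  (e0 : a * (B 0 0)%:C + b * (B 1 0)%:C = l1 * a)
  (e1 : a * (B 0 1)%:C + b * (B 1 1)%:C = l1 * b)
  (l1_gt1 : 1 < normc l1).

(** The left eigenvector [(a, b)] for [l1] as a linear form; its values are complex because [l1] may
    be non-real. *)
Definition eform p : R[i] := a * p.1%:C + b * p.2%:C.

Definition enorm p : R := normc (eform p).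

Lemma enorm_ge0 p : 0 <= enorm p.
Proof. by rewrite /enorm; case: eform => x y; exact: sqrtr_ge0. Qed.

Lemma normcR (c : R) : normc c%:C = `|c|.
Proof. by rewrite /= expr0n /= addr0 sqrtr_sqr. Qed.

Lemma eform_lact p : eform (lact B p) = l1 * eform p.
Proof.
transitivity ((l1 * a) * p.1%:C + (l1 * b) * p.2%:C); last by rewrite /eform; ring.
by rewrite -e0 -e1 /eform /= !rmorphD !rmorphM /=; ring.
Qed.

Lemma enorm_lact p : enorm (lact B p) = normc l1 * enorm p.
Proof. by rewrite /enorm eform_lact Normc.normcM. Qed.

Lemma l1_neq0 : normc l1 != 0.
Proof. by rewrite gt_eqF// (lt_trans _ l1_gt1). Qed.

Lemma enorm_beta n p : enorm (beta B n p) = normc l1 ^ n * enorm p.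
Proof.
have pos (m : nat) q : enorm (beta B m q) = normc l1 ^+ m * enorm q.
  elim: m q => [|m IH] q; first by rewrite /beta expr0z lact1 expr0 mul1r.
  rewrite /beta intS exprzDr// expr1z lactM enorm_lact -/(beta B m q) IH.
  by rewrite exprS mulrA.
case: n => n; first exact: pos.
rewrite NegzE -exprnN; apply: (mulfI (expf_neq0 n.+1 l1_neq0)).
rewrite mulrA divff ?mul1r; last exact: expf_neq0 l1_neq0.
by rewrite -pos -(actD (maction_beta uB)) addrN (act0 (maction_beta uB)).
Qed.

Lemma enormD p q : enorm (p + q) <= enorm p + enorm q.
Proof.
rewrite /enorm (_ : eform (p + q) = eform p + eform q); first exact: le_normcD.
by rewrite /eform /= !rmorphD; ring.
Qed.

Lemma enormZ (c : R) p : enorm (c * p.1, c * p.2) = `|c| * enorm p.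
Proof.
rewrite /enorm -normcR -Normc.normcM; congr normc.
by rewrite /eform /= !rmorphM; ring.
Qed.

Lemma enorm_bound p (m : R) : `|p.1| <= m -> `|p.2| <= m ->
  enorm p <= (normc a + normc b) * m.
Proof.
move=> p1 p2; apply: (le_trans (le_normcD _ _)).
rewrite !Normc.normcM !normcR mulrDl.
have ge0 z : 0 <= normc z by case: z => x y; exact: sqrtr_ge0.
by apply: lerD; apply: ler_wpM2l.
Qed.

Lemma measurable_enorm : measurable_fun setT (enorm : X -> measurableTypeR R).
Proof.
rewrite (_ : enorm = (Num.sqrt \o fun p : X =>
    (complex.Re a * p.1 + complex.Re b * p.2) ^+ 2 +
    (complex.Im a * p.1 + complex.Im b * p.2) ^+ 2)); last first.
  apply/funext => p; rewrite /enorm /eform /=; case: a b => [a1 a2] [b1 b2] /=.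
  by congr Num.sqrt; ring.
apply: measurableT_comp.
  by apply: continuous_measurable_fun; exact: sqrt_continuous.
by apply: measurable_funD; apply: measurable_funX; apply: measurable_funD;
  apply: measurable_funM.
Qed.

Lemma enorm_eq0 p : enorm p = 0 -> eform p = 0.
Proof. exact: Normc.eq0_normc. Qed.

(** The real and imaginary parts of the eigenform are real linear forms, at least one of them
    nonzero, so the zero set lies in a line. *)
Lemma enorm0_null : mu.-negligible [set p | enorm p = 0].
Proof.
have reim p : enorm p = 0 -> complex.Re a * p.1 + complex.Re b * p.2 = 0 /\
    complex.Im a * p.1 + complex.Im b * p.2 = 0.
  move/enorm_eq0; rewrite /eform; case: a b => [a1 a2] [b1 b2] /= /eqP.
  rewrite eq_complex /= => /andP[/eqP h1 /eqP h2].
  by split; [rewrite -h1|rewrite -h2]; ring.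
have [h|h] := boolP ((complex.Re a != 0) || (complex.Re b != 0)).
  by apply: negligibleS (line_null h) => p /reim[].
have [h'|h'] := boolP ((complex.Im a != 0) || (complex.Im b != 0)).
  by apply: negligibleS (line_null h') => p /reim[].
move: h h' ab0; rewrite !negb_or !negbK; case: a b => [a1 a2] [b1 b2] /=.
by move=> /andP[/eqP-> /eqP->] /andP[/eqP-> /eqP->]; rewrite eqxx.
Qed.

Definition annulus (c : R) : set X :=
  [set p | c <= enorm p < normc l1 * c].

Lemma measurable_annulus c : measurable (annulus c).
Proof.
rewrite (_ : annulus c = enorm @^-1` `[c, normc l1 * c[); last first.
  by apply/seteqP; split=> p /=; rewrite in_itv.
by rewrite -[_ @^-1` _]setTI; exact: measurable_enorm.
Qed.

Lemma packing_annulus c : 0 < c -> packing (beta B) (annulus c).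
Proof.
move=> c0; have L0 : 0 < normc l1 := lt_trans ltr01 l1_gt1.
have up n p : (0 < n) -> annulus c p -> ~ annulus c (beta B n p).
  case: n => [[|n]|]// _ /andP[h1 h2] /andP[_]; rewrite enorm_beta; apply/negP.
  rewrite -leNgt; apply: ler_pM => //; [exact: ltW|exact: ltW|].
  rewrite -exprnP exprS; apply: ler_peMr; first exact: ltW.
  by apply: exprn_ege1; exact: ltW.
move=> n p cp cn; have [n0|n0|//] := ltrgt0P n; first by case: (up _ _ n0 cp).
have := up (- n) (beta B n p); rewrite oppr_gt0 => /(_ n0 cn).
by rewrite -(actD (maction_beta uB)) addNr (act0 (maction_beta uB)).
Qed.

Lemma eform_ker (x y : R[i]) : a * x + b * y = 0 ->
  exists s, x = s * b /\ y = - (s * a).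
Proof.
move=> axby; have [a0|a0] := eqVneq a 0.
  have b0 : b != 0 by move: ab0; rewrite a0 eqxx.
  move: axby; rewrite a0 mul0r add0r => /eqP.
  rewrite mulf_eq0 (negbTE b0) /= => /eqP->.
  by exists (x / b); rewrite divfK// mulr0 oppr0.
exists (- (y / a)); rewrite !mulNr divfK// opprK; split=> //.
apply: (mulfI a0); rewrite mulrN mulrA (mulrCA a) mulfV// mulr1.
by apply/eqP; rewrite -addr_eq0 (mulrC y) axby.
Qed.

(** The kernel is the invariant line spanned by [(b, - a)], where [B] acts by its trace minus
    [l1]. *)
Lemma eform_ker_eigen (x y : R[i]) : a * x + b * y = 0 ->
  (B 0 0)%:C * x + (B 0 1)%:C * y = l2 * x /\
  (B 1 0)%:C * x + (B 1 1)%:C * y = l2 * y.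
Proof.
move=> /eform_ker[s [-> ->]].
have trC : (B 0 0)%:C + (B 1 1)%:C = l1 + l2 by rewrite -trB rmorphD.
have l2E : l2 = (B 0 0)%:C + (B 1 1)%:C - l1 by rewrite trC addrC addKr.
have -> : (B 0 0)%:C * (s * b) + (B 0 1)%:C * - (s * a) =
  s * ((B 0 0)%:C * b + (B 1 1)%:C * b - (a * (B 0 1)%:C + b * (B 1 1)%:C)) by ring.
have -> : (B 1 0)%:C * (s * b) + (B 1 1)%:C * - (s * a) =
  - s * ((B 0 0)%:C * a + (B 1 1)%:C * a - (a * (B 0 0)%:C + b * (B 1 0)%:C)) by ring.
by rewrite e0 e1 l2E; split; ring.
Qed.

(** Left and right eigenvectors for distinct eigenvalues annihilate each other. *)
Lemma eigen_eform_ker (x y : R[i]) : l1 != l2 ->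
  (B 0 0)%:C * x + (B 0 1)%:C * y = l2 * x ->
  (B 1 0)%:C * x + (B 1 1)%:C * y = l2 * y -> a * x + b * y = 0.
Proof.
move=> l12 h1 h2; apply/eqP; move: l12; rewrite -subr_eq0 => l12.
rewrite -(mulrI_eq0 _ (mulfI l12)) mulrBl subr_eq0; apply/eqP.
transitivity ((l1 * a) * x + (l1 * b) * y); first by ring.
rewrite -e0 -e1.
transitivity (a * (l2 * x) + b * (l2 * y)); last by ring.
by rewrite -h1 -h2; ring.
Qed.

Lemma expr_unbounded (c x : R) : 1 < c ->
  exists N, forall n : nat, (N <= n)%N -> x < c ^+ n.
Proof.
move=> c1; have bern (n : nat) : 1 + n%:R * (c - 1) <= c ^+ n.
  elim: n => [|n IH]; first by rewrite mul0r addr0.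
  rewrite exprS -natr1; apply: (@le_trans _ _ (c * (1 + n%:R * (c - 1)))).
    have : 0 <= n%:R * (c - 1) ^+ 2 by rewrite mulr_ge0// sqr_ge0.
    by lra.
  by rewrite ler_pM2l// (lt_trans _ c1).
have h : 0 < c - 1 by rewrite subr_gt0.
exists (Num.bound (`|x| / (c - 1))) => n Nn; apply: lt_le_trans (bern n).
have := archi_boundP (divr_ge0 (normr_ge0 x) (ltW h)).
rewrite ltr_pdivrMr// => xb; apply: (le_lt_trans (ler_norm x)).
apply: (lt_le_trans xb); apply: (@le_trans _ _ (n%:R * (c - 1))).
  by rewrite ler_pM2r// ler_nat.
by rewrite lerDr.
Qed.

Lemma normc_ge0 z : 0 <= normc z.
Proof. by case: z => x y; exact: sqrtr_ge0. Qed.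

Lemma normc_gt0 z : (0 < normc z) = (z != 0).
Proof.
rewrite lt_neqAle normc_ge0 andbT eq_sym; congr (~~ _); apply/eqP/eqP => [|->].
  exact: Normc.eq0_normc.
exact: Normc.normc0.
Qed.

Lemma annulus_unit_box : exists u v, exists2 c, 0 < c & unit_box u v `<=` annulus c.
Proof.
set L := normc l1; have L1 : 1 < L := l1_gt1.
set K := normc a + normc b; have K0 : 0 <= K by rewrite addr_ge0 ?normc_ge0.
have [p0 p0_gt0] : exists p0, 0 < enorm p0.
  have [a0|b0] := orP ab0.
    by exists (1, 0); rewrite /enorm /eform /= mulr0 addr0 mulr1 normc_gt0.
  by exists (0, 1); rewrite /enorm /eform /= mulr0 add0r mulr1 normc_gt0.
(* On the box at [s * p0] the values of [enorm] stay within [K] of [t]. An annulus of inner radius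
   [t - K] contains it once [t + K < L * (t - K)], that is [K * (L + 1) < (L - 1) * t]. *)
pose t := K * (L + 1) / (L - 1) + 1; pose s := t / enorm p0.
have L10 : 0 < L - 1 by rewrite subr_gt0.
have tL : (L - 1) * t = K * (L + 1) + (L - 1).
  by rewrite /t; field; rewrite gt_eqF.
have tK : K < t.
  rewrite -(ltr_pM2l L10) tL; have : 0 <= K by []. by nra.
have st : enorm (s * p0.1, s * p0.2) = t.
  rewrite enormZ ger0_norm /s ?divfK ?gt_eqF//.
  by rewrite divr_ge0 ?ltW// (le_lt_trans K0).
exists (s * p0.1), (s * p0.2), (t - K); first by rewrite subr_gt0.
move=> q /unit_boxP[/andP[q1 q1'] /andP[q2 q2']].
pose w : X := (q.1 - s * p0.1, q.2 - s * p0.2).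
have w1 : `|w.1| <= 1 by rewrite ler_norml /w /=; apply/andP; split; lra.
have w2 : `|w.2| <= 1 by rewrite ler_norml /w /=; apply/andP; split; lra.
have wK : enorm w <= K by have := enorm_bound w1 w2; rewrite mulr1.
have w1' : `|(- w).1| <= 1 by rewrite normrN.
have w2' : `|(- w).2| <= 1 by rewrite normrN.
have wK' : enorm (- w) <= K by have := enorm_bound w1' w2'; rewrite mulr1.
have qE : q = (s * p0.1, s * p0.2) + w.
  rewrite [LHS]surjective_pairing; apply/pair_equal_spec.
  by rewrite /w /=; split; rewrite addrC subrK.
have qE' : (s * p0.1, s * p0.2) = q + (- w) by rewrite {1}qE addrK.
rewrite /annulus /=; apply/andP; split.
  by rewrite lerBlDr -{1}st {1}qE'; apply: (le_trans (enormD _ _)); rewrite lerD2l.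
rewrite qE; apply: (le_lt_trans (enormD _ _)); rewrite st.
apply: (@le_lt_trans _ _ (t + K)); first by rewrite lerD2l.
by rewrite -/L; lra.
Qed.

Lemma exists_double_tile : 1 < `|\det B| ->
  (forall N, exists2 j, (N <= j)%N & lattice_free B j) ->
  exists E, double_tile B E.
Proof.
move=> detB freeB; have mbeta := maction_beta uB.
(* Annuli of positive rational inner radius: a rational between [enorm p / normc l1] and [enorm p]
   serves for [p], so they cover all points off the null set [enorm p = 0]. Other codes give the
   empty set. *)
pose W (n : nat) : set X := if (unpickle n : option rat) is Some q
  then if 0 < ratr q :> R then annulus (ratr q) else set0 else set0.
have mW (n : nat) : measurable (W n).
  rewrite /W; case: unpickle => // q; case: ifP => // _; exact: measurable_annulus.
have pW (n : nat) : packing (beta B) (W n).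
  rewrite /W; case: unpickle => [q|]; last by move=> i p [].
  by case: ifP => [q0|_]; [exact: packing_annulus|move=> i p []].
have cW : mu.-negligible (~` \bigcup_n W n).
  apply: negligibleS enorm0_null => p np /=; apply: contrapT => /eqP p0.
  have {}p0 : 0 < enorm p by rewrite lt_neqAle eq_sym p0 enorm_ge0.
  have L0 : 0 < normc l1 := lt_trans ltr01 l1_gt1.
  have : enorm p / normc l1 < enorm p by rewrite ltr_pdivrMr// ltr_pMr.
  move=> /rat_in_itvoo[s]; rewrite in_itv /= => /andP[q1 q2].
  apply: np; exists (pickle s); first exact: I.
  rewrite /W pickleK.
  rewrite (lt_trans _ q1) ?divr_gt0// /annulus /= ltW//=.
  by rewrite mulrC -ltr_pdivrMr.
have [P [mP pP qP cP]] := dilation_tile_packing uB detB freeB mW pW cW.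
have [u [v [c c0 Qc]]] := annulus_unit_box.
have qQ : packing (beta B) (unit_box u v).
  by apply: (packingS Qc); exact: packing_annulus.
have [E [mE pE qE tE bE]] := simultaneous_packing countable_int2 countable_int
  maction_tau mbeta mP (measurable_unit_box u v) pP qP
  (@packing_tau_unit_box _ u v) qQ.
exists E; split=> //.
  apply: (@negligibleS _ _ _ _ set0); last exact: negligible_set0.
  by move=> p; apply; apply: tE; rewrite sat_tau_unit_box.
by apply: negligibleS cP => p np /bE.
Qed.

Definition cross p q : R := p.1 * q.2 - p.2 * q.1.

Lemma cross_lact (M : 'M[R]_2) p q :
  cross (lact M p) (lact M q) = \det M * cross p q.
Proof. by rewrite det2E /cross /lact /=; ring. Qed.

Lemma cross_lattice (s t : int * int) :
  cross (lattice_pt s) (lattice_pt t) = (s.1 * t.2 - s.2 * t.1)%:~R.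
Proof. by rewrite /cross /= intrB !intrM. Qed.

Lemma int_ge1 (z : int) : z != 0 -> 1 <= `|z%:~R : R|.
Proof. by move=> z0; rewrite -intr_norm ler1z; lia. Qed.

(** Parallelism is transitive through a nonzero vector: both coordinates of [t] annihilate the
    determinant of [s] and [u]. *)
Lemma cross_eq0_trans (s t u : int * int) : t != 0 ->
  s.1 * t.2 - s.2 * t.1 = 0 -> t.1 * u.2 - t.2 * u.1 = 0 ->
  s.1 * u.2 - s.2 * u.1 = 0.
Proof.
case: s t u => [s1 s2] [t1 t2] [u1 u2] /= t0 /eqP; rewrite subr_eq0 => /eqP h.
move=> /eqP; rewrite subr_eq0 => /eqP h'.
have e1' : t1 * (s1 * u2 - s2 * u1) = 0.
  transitivity (s1 * (t1 * u2) - t1 * s2 * u1); first by ring.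
  rewrite h'; transitivity ((s1 * t2) * u1 - t1 * s2 * u1); first by ring.
  by rewrite h; ring.
have e2' : t2 * (s1 * u2 - s2 * u1) = 0.
  transitivity ((s1 * t2) * u2 - t2 * u1 * s2); first by ring.
  rewrite h -h'; ring.
apply/eqP; apply: contraT => n0; move/eqP: t0; case.
move/eqP: e1'; move/eqP: e2'; rewrite !mulf_eq0 (negbTE n0) !orbF.
by move=> /eqP-> /eqP->.
Qed.

(** Parallel integer vectors satisfy [t1 * s = s1 * t] and [t2 * s = s2 * t], and a nonzero integer
    has modulus at least 1. The factor depends on [s] only, which bounds [enorm] from below on the
    nonzero lattice points of a whole line. *)
Lemma enorm_lattice_parallel (s t : int * int) : t != 0 ->
  s.1 * t.2 - s.2 * t.1 = 0 ->
  enorm (lattice_pt s) <= (`|s.1|%:~R + `|s.2|%:~R) * enorm (lattice_pt t).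
Proof.
case: s t => [s1 s2] [t1 t2] /= t0 /eqP; rewrite subr_eq0 => /eqP st.
have ge0 := enorm_ge0.
have key (x y : int) : x * s1 = y * t1 -> x * s2 = y * t2 -> x != 0 ->
    enorm (lattice_pt (s1, s2)) <= `|y|%:~R * enorm (lattice_pt (t1, t2)).
  move=> h1 h2 x0.
  have e : (y%:~R * (lattice_pt (t1, t2)).1, y%:~R * (lattice_pt (t1, t2)).2)
      = (x%:~R * (lattice_pt (s1, s2)).1, x%:~R * (lattice_pt (s1, s2)).2) :> X.
    by rewrite /= -!intrM h1 h2.
  have := congr1 enorm e.
  rewrite (enormZ _ (lattice_pt (t1, t2))) (enormZ _ (lattice_pt (s1, s2))).
  rewrite intr_norm => ->; apply: ler_peMl; first exact: enorm_ge0.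
  exact: int_ge1.
have [t10|t10] := eqVneq t1 0.
  have t20 : t2 != 0 by apply: contraNneq t0 => ->; rewrite t10.
  apply: le_trans (key t2 s2 (etrans (mulrC _ _) st) (mulrC _ _) t20) _.
  by rewrite ler_wpM2r// lerDr ler0z normr_ge0.
apply: le_trans (key t1 s1 (mulrC _ _) (esym (etrans st (mulrC _ _))) t10) _.
by rewrite ler_wpM2r// lerDl ler0z normr_ge0.
Qed.

Lemma eform_lattice_beta (t : int * int) (j : nat) : eform (lattice_pt t) = 0 ->
  ((beta B j (lattice_pt t)).1)%:C = l2 ^+ j * (t.1%:~R)%:C /\
  ((beta B j (lattice_pt t)).2)%:C = l2 ^+ j * (t.2%:~R)%:C.
Proof.
move=> t0; elim: j => [|j [IH1 IH2]].
  by rewrite /beta expr0z lact1 expr0 !mul1r.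
have -> : beta B j.+1 (lattice_pt t) = lact B (beta B j (lattice_pt t)).
  by rewrite /beta intS exprzDr// expr1z lactM.
have ej : eform (beta B j (lattice_pt t)) = 0.
  apply: Normc.eq0_normc; rewrite -/(enorm _) enorm_beta// /enorm t0.
  by rewrite Normc.normc0 mulr0.
have [h1 h2] := eform_ker_eigen ej.
rewrite /lact /= !rmorphD !rmorphM /= h1 h2 IH1 IH2 !exprS; split; ring.
Qed.

Hypotheses (detB : 1 < `|\det B|)
  (eigB : forall t : int * int, t != 0 -> eform (lattice_pt t) = 0 -> 1 <= normc l2).

(* If [B ^ j] maps some nonzero lattice point [t j] into the unit square for all
   large [j], the determinant of [t j] and [t j.+1] is at most a constant times
   [`|\det B| ^- j], hence [0] as it is an integer: the [t j] all lie on a line.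
   The eigenform vanishes on that line since it grows like [l1 ^ j], so the [t j]
   are eigenvectors for [l2]. *)
Lemma lattice_free_frequently N : exists2 j, (N <= j)%N & lattice_free B j.
Proof.
apply: contrapT => nfree.
have {nfree} small j : exists t : int * int, (N <= j)%N -> [/\ t != 0,
    `|(beta B j (lattice_pt t)).1| < 1 & `|(beta B j (lattice_pt t)).2| < 1].
  have [Nj|Nj] := boolP (N <= j)%N; last by exists 0.
  apply: contrapT => nt; apply: nfree; exists j => // t t1 t2.
  by apply/eqP; apply: contrapT => /negP t0; apply: nt; exists t.
pose t j := projT1 (cid (small j)).
have tP j : (N <= j)%N -> [/\ t j != 0,
    `|(beta B j (lattice_pt (t j))).1| < 1 & `|(beta B j (lattice_pt (t j))).2| < 1].
  exact: (projT2 (cid (small j))).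
pose x (j : nat) : X := beta B j (lattice_pt (t j)).
pose M := B ^-1.
(* [C] bounds both coordinates of [B^-1] on the unit square. So the determinant of [x j] and
   [B^-1 (x j.+1)] is at most [C + C], while it is [\det B ^ j] times an integer. *)
pose C := `|M 0 0| + `|M 0 1| + (`|M 1 0| + `|M 1 1|).
have [N1 N1P] := expr_unbounded (C + C) detB.
have par j : (N <= j)%N -> (N1 <= j)%N ->
    (t j).1 * (t j.+1).2 - (t j).2 * (t j.+1).1 = 0.
  move=> Nj N1j; apply/eqP; apply: contrapT => /negP /int_ge1.
  rewrite -cross_lattice => c1.
  have [_ x1 x2] := tP _ Nj.
  have [_ y1 y2] := tP _ (leqW Nj).
  pose y : X := beta B j (lattice_pt (t j.+1)).
  have yE : y = lact M (x j.+1).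
    rewrite /y /x /beta -lactM /M -exprN1 -exprzDr// intS.
    by rewrite addrA addNr add0r.
  have C1 : `|y.1| <= C.
    rewrite yE /lact /=; apply: (le_trans (ler_normD _ _)); rewrite !normrM.
    apply: (@le_trans _ _ (`|M 0 0| + `|M 0 1|)).
      by apply: lerD; rewrite ler_piMr// ltW.
    by rewrite lerDl addr_ge0.
  have C2 : `|y.2| <= C.
    rewrite yE /lact /=; apply: (le_trans (ler_normD _ _)); rewrite !normrM.
    apply: (@le_trans _ _ (`|M 1 0| + `|M 1 1|)).
      by apply: lerD; rewrite ler_piMr// ltW.
    by rewrite lerDr addr_ge0.
  have : `|cross (x j) y| <= C + C.
    rewrite /cross; apply: (le_trans (ler_normB _ _)); rewrite !normrM.
    by apply: lerD; rewrite -[leRHS]mul1r ler_pM// ltW.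
  rewrite /x /y /beta cross_lact det_exprz normrM normr_exprz => h.
  have := N1P _ N1j; rewrite ltNge => /negP; apply; apply: le_trans h.
  by rewrite -exprnP ler_peMr.
pose n0 := maxn N N1.
have par0 j : (n0 <= j)%N -> (t n0).1 * (t j).2 - (t n0).2 * (t j).1 = 0.
  elim: j => [|j IH]; first by rewrite leqn0 => /eqP->; ring.
  rewrite leq_eqVlt => /orP[/eqP->|]; first by ring.
  rewrite ltnS => nj; have Nj : (N <= j)%N by rewrite (leq_trans _ nj) ?leq_maxl.
  have N1j : (N1 <= j)%N by rewrite (leq_trans _ nj) ?leq_maxr.
  have [tj0 _ _] := tP _ Nj.
  exact: cross_eq0_trans tj0 (IH nj) (par _ Nj N1j).
have tn0 : eform (lattice_pt (t n0)) = 0.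
  apply: Normc.eq0_normc; apply/eqP; apply: contrapT => /negP n00.
  have {}n00 : 0 < enorm (lattice_pt (t n0)).
    by rewrite lt_neqAle eq_sym n00 enorm_ge0.
  pose m : R := `|(t n0).1|%:~R + `|(t n0).2|%:~R.
  have m0 : 0 <= m by rewrite addr_ge0// ler0z.
  pose K := normc a + normc b.
  (* If the form is nonzero at [t n0], then [enorm] at [t j] is at least
     [enorm (lattice_pt (t n0)) / m]; but [B ^ j] multiplies it by [normc l1 ^+ j] and must leave it
     at most [K]. *)
  have [N2 N2P] := expr_unbounded (m * K / enorm (lattice_pt (t n0))) l1_gt1.
  pose j := maxn n0 N2.
  have nj : (n0 <= j)%N by rewrite leq_maxl.
  have Nj : (N <= j)%N by rewrite (leq_trans _ nj)// leq_maxl.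
  have := N2P j (leq_maxr _ _); rewrite ltr_pdivrMr// ltNge => /negP; apply.
  have [tj0 x1 x2] := tP _ Nj.
  have Lj : 0 <= normc l1 ^+ j by rewrite exprn_ge0// normc_ge0.
  apply: (@le_trans _ _ (normc l1 ^+ j * (m * enorm (lattice_pt (t j))))).
    by apply: ler_wpM2l => //; exact: enorm_lattice_parallel tj0 (par0 _ nj).
  rewrite mulrCA; apply: ler_wpM2l => //.
  rewrite exprnP -enorm_beta//; apply: (le_trans (enorm_bound (ltW x1) (ltW x2))).
  by rewrite mulr1.
have Nn0 : (N <= n0)%N by rewrite leq_maxl.
have [tn00 x1 x2] := tP _ Nn0.
have l2_ge1 : 1 <= normc l2 ^+ n0 by rewrite exprn_ege1// (eigB tn00 tn0).
have big (z : R) (w : int) : z%:C = l2 ^+ n0 * (w%:~R)%:C -> `|z| < 1 -> w = 0.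
  move=> zE z1; apply/eqP; apply: contrapT => /negP /int_ge1 w1.
  have : normc z%:C = normc l2 ^+ n0 * `|w%:~R|.
    rewrite zE Normc.normcM normcR; congr (_ * _).
    by elim: n0 {Nn0 tn0 par0 tn00 x1 x2 l2_ge1 zE} => [|k IH];
      rewrite ?expr0 ?Normc.normc1// !exprS Normc.normcM IH.
  rewrite normcR => zE'; move: z1; rewrite zE' ltNge => /negP; apply.
  by apply: (le_trans l2_ge1); apply: ler_peMr => //; exact: le_trans ler01 l2_ge1.
have [E1 E2] := eform_lattice_beta n0 tn0.
case/eqP: tn00; rewrite [LHS]surjective_pairing.
by rewrite (big _ _ E1 x1) (big _ _ E2 x2).
Qed.

Lemma lactZ (M : 'M[R]_2) (c : R) p :
  lact M (c * p.1, c * p.2) = (c * (lact M p).1, c * (lact M p).2).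
Proof. by rewrite /lact /=; congr pair; ring. Qed.

(** * A lattice point in the contracted eigenline *)

Section Contracted_lattice_point.
Variables (w : int * int) (E : set X).
Hypotheses (w0 : w != 0) (ew0 : eform (lattice_pt w) = 0) (l2_lt1 : normc l2 < 1)
  (tE : double_tile B E).

Let w1 : R := w.1%:~R.
Let w2 : R := w.2%:~R.
Let nw : R := w1 ^+ 2 + w2 ^+ 2.

Let nw_gt0 : 0 < nw.
Proof.
rewrite lt_neqAle addr_ge0 ?sqr_ge0// andbT eq_sym paddr_eq0 ?sqr_ge0//.
rewrite !expf_eq0 /= !intr_eq0; apply: contra_neqN w0 => /andP[/eqP h1 /eqP h2].
by rewrite [LHS]surjective_pairing h1 h2.
Qed.

Let nw0 : nw != 0. Proof. by rewrite gt_eqF. Qed.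

(** Orthogonal projection to the line of [w], measured in units of [w]. *)
Let height p : R := (p.1 * w1 + p.2 * w2) / nw.

Let height_shift p (s : R) : height (p.1 + s * w1, p.2 + s * w2) = height p + s.
Proof. by rewrite /height /nw /=; field. Qed.

Let eform_shift p (s : R) : eform (p.1 + s * w1, p.2 + s * w2) = eform p.
Proof.
transitivity (eform p + s%:C * eform (lattice_pt w)).
  by rewrite /eform /= !rmorphD !rmorphM /=; ring.
by rewrite ew0 mulr0 addr0.
Qed.

(** [w] is a real eigenvector for [l2], so a nonzero coordinate of [w] exhibits [l2] as a real
    quotient; it is nonzero since [B] is invertible. *)
Let eigenvalue_real : exists l : R, [/\ l != 0, `|l| < 1 &
  forall n, beta B n (lattice_pt w) = (l ^ n * w1, l ^ n * w2)].
Proof.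
have [h1 h2] := eform_ker_eigen ew0.
have [l l2E] : exists l : R, l2 = l%:C.
  have [z1|z1] := eqVneq w1 0.
    have z2 : w2 != 0.
      by move: nw0; rewrite /nw z1; apply: contraNneq => ->; rewrite expr0n addr0.
    exists ((B 1 0 * w1 + B 1 1 * w2) / w2); apply: (mulIf (x := w2%:C)).
      by rewrite eq_complex /= eqxx andbT.
    by rewrite -h2 -[RHS]rmorphM /= divfK// rmorphD !rmorphM.
  exists ((B 0 0 * w1 + B 0 1 * w2) / w1); apply: (mulIf (x := w1%:C)).
    by rewrite eq_complex /= eqxx andbT.
  by rewrite -h1 -[RHS]rmorphM /= divfK// rmorphD !rmorphM.
have lactl (s : R) : lact B (s * w1, s * w2) = (l * s * w1, l * s * w2).
  move: h1 h2; rewrite l2E -!rmorphM -!rmorphD => /complexI h1 /complexI h2.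
  rewrite /lact /=; apply/pair_equal_spec; split.
    by transitivity (s * (B 0 0 * w1 + B 0 1 * w2)); [ring|rewrite h1 /w1 /=; ring].
  by transitivity (s * (B 1 0 * w1 + B 1 1 * w2)); [ring|rewrite h2 /w2 /=; ring].
have mbeta := maction_beta uB.
have wE : lattice_pt w = (1 * w1, 1 * w2) by rewrite !mul1r.
have l0 : l != 0.
  apply: contraTneq isT => l0.
  have : beta B (-1) (lact B (lattice_pt w)) = lattice_pt w.
    have -> : lact B (lattice_pt w) = beta B 1 (lattice_pt w) by rewrite /beta expr1z.
    by rewrite -(actD mbeta) addNr (act0 mbeta).
  rewrite wE lactl l0 !mul0r /beta /lact /= !mulr0 addr0 !mul1r.
  by move=> [h h']; move: nw_gt0; rewrite /nw -h -h' expr0n addr0 ltxx.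
exists l; split=> //; first by rewrite -normcR -l2E.
have pos (m : nat) (s : R) : beta B m (s * w1, s * w2) =
    (l ^+ m * s * w1, l ^+ m * s * w2).
  elim: m s => [|m IH] s; first by rewrite (act0 mbeta) expr0 mul1r.
  have -> : beta B m.+1 (s * w1, s * w2) = beta B m (lact B (s * w1, s * w2)).
    by rewrite /beta intS addrC exprzDr// expr1z lactM.
  by rewrite lactl IH exprSr mulrA.
case=> m; first by rewrite wE pos mulr1.
rewrite NegzE -exprnN wE.
have := actK mbeta m.+1 (l ^- m.+1 * w1, l ^- m.+1 * w2).
by rewrite pos mulfV ?expf_neq0.
Qed.

(** Dividing by [t] allows negative heights [t], which occur as powers of a negative eigenvalue. *)
Let strip (c t : R) : set X :=
  [set p | annulus c p /\ 0 <= height p / t < 1].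

Let measurable_strip c t : measurable (strip c t).
Proof.
rewrite (_ : strip c t = annulus c `&`
   ((fun p : X => height p / t : measurableTypeR R) @^-1` [set` `[0, 1[%R])).
  apply: measurableI; first exact: measurable_annulus.
  rewrite -[_ @^-1` _]setTI.
  suff : measurable_fun setT (fun p : X => height p / t : measurableTypeR R) by apply.
  by rewrite /height; apply: measurable_funM => //; apply: measurable_funM => //;
    apply: measurable_funD; apply: measurable_funM.
by apply/seteqP; split=> p; rewrite /strip /= in_itv.
Qed.

Let mu_strip c t : t != 0 -> mu (strip c t) = (`|t|%:E * mu (strip c 1))%E.
Proof.
(* [M] stretches by [t] along [w] and fixes the orthogonal direction, so it preserves the eigenform
   and multiplies [height] by [t]. *)
move=> t0; pose M : 'M[R]_2 := \matrix_(i, j) ((i == j)%:R +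
  (t - 1) / nw * (if i == 0 then w1 else w2) * (if j == 0 then w1 else w2)).
have detM : \det M = t by rewrite det2E !mxE /= /nw; field.
have uM : M \in unitmx by rewrite unitmxE detM unitfE.
have ME p : lact M p = (p.1 + (t - 1) * height p * w1, p.2 + (t - 1) * height p * w2).
  by rewrite /lact !mxE /= /height; apply/pair_equal_spec; split; ring.
rewrite (lebesgue_measure2_lact uM (measurable_strip c t)) detM.
congr (_ * mu _)%E; apply/seteqP.
have hE p : height (lact M p) / t = height p / 1.
  by rewrite ME height_shift; field.
have eE p : enorm (lact M p) = enorm p by rewrite /enorm ME eform_shift.
by split=> p; rewrite /strip /annulus /= hE eE.
Qed.

(** The strip is bounded: [height] controls the coordinate along [w], and the annulus controls the
    orthogonal one, since the eigenform cannot also vanish at the rotated vector [u]. *)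
Let strip_finite c : (mu (strip c 1) < +oo)%E.
Proof.
pose u : X := (- w2, w1).
have eu0 : 0 < enorm u.
  rewrite normc_gt0; apply: contraTneq ab0 => eu.
  have ka : nw%:C * a = w1%:C * eform (lattice_pt w) - w2%:C * eform u.
    by rewrite /nw /eform /= !rmorphD !rmorphXn /= rmorphN; ring.
  have kb : nw%:C * b = w2%:C * eform (lattice_pt w) + w1%:C * eform u.
    by rewrite /nw /eform /= !rmorphD !rmorphXn /= rmorphN; ring.
  have nwC : nw%:C != 0 by rewrite eq_complex /= eqxx andbT.
  move/eqP: ka; move/eqP: kb; rewrite ew0 eu !mulr0 subr0 addr0 !mulf_eq0.
  by rewrite (negbTE nwC) /= => /eqP-> /eqP->; rewrite eqxx.
pose g p := (p.2 * w1 - p.1 * w2) / nw.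
have gE p : eform p = (g p)%:C * eform u.
  rewrite -(eform_shift p (- height p)).
  transitivity (eform (g p * u.1, g p * u.2)).
    congr eform; apply/pair_equal_spec; rewrite /height /g /u /nw /=.
    by split; field.
  by rewrite /eform /= !rmorphM; ring.
pose K := normc l1 * c / enorm u.
(* From [p = height p * w + g p * u] with [height] at most 1 and [g] at most [K] in modulus; one
   crude bound serves both coordinates. *)
pose N := `|w1| + `|w2| + K * (`|w1| + `|w2|).
pose box : set X := [set` `[- N, N]%R] `*` [set` `[- N, N]%R].
have mitv : measurable ([set` `[- N, N]%R] : set (measurableTypeR R)).
  exact: measurable_itv.
have boxE : mu box = (@lebesgue_measure R [set` `[- N, N]%R] *
    @lebesgue_measure R [set` `[- N, N]%R])%E.
  exact: product_measure1E.
apply: (@le_lt_trans _ _ (mu box)); last first.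
  rewrite boxE lebesgue_measure_itv /=; case: ifP => _; last by rewrite mule0 ltry.
  by rewrite -EFinD -EFinM ltry.
apply: le_measure; rewrite ?inE; [exact: measurable_strip|exact: measurableX|].
move=> p [/andP[_ pc]]; rewrite divr1 => /andP[h0 h1].
have gK : `|g p| <= K.
  rewrite /K ler_pdivlMr// ltW//; apply: le_lt_trans pc.
  by rewrite /enorm (gE p) Normc.normcM normcR.
have hle : `|height p| <= 1 by rewrite ger0_norm// ltW.
have K0 : 0 <= K by rewrite (le_trans _ gK).
have p1 : p.1 = height p * w1 - g p * w2 by rewrite /height /g /nw; field.
have p2 : p.2 = height p * w2 + g p * w1 by rewrite /height /g /nw; field.
split; rewrite /= in_itv /= -ler_norml.
  rewrite p1; apply: (le_trans (ler_normB _ _)).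
  rewrite (normrM (height p)) (normrM (g p)).
  apply: (@le_trans _ _ (`|w1| + K * `|w2|)).
    by apply: lerD; [rewrite ler_piMl|rewrite ler_wpM2r].
  by rewrite /N mulrDr; apply: lerD; [rewrite lerDl|rewrite lerDr mulr_ge0].
rewrite p2; apply: (le_trans (ler_normD _ _)).
rewrite (normrM (height p)) (normrM (g p)).
apply: (@le_trans _ _ (`|w2| + K * `|w1|)).
  by apply: lerD; [rewrite ler_piMl|rewrite ler_wpM2r].
by rewrite /N mulrDr; apply: lerD; [rewrite lerDr|rewrite lerDl mulr_ge0].
Qed.

(* [B ^ k E] packs by translations along [B ^ k w = l ^ k w], so it meets the
   annulus in a set no larger than a strip of height [l ^ k]. *)
Let annulus_dilate_le c (l : R) (k : nat) : l != 0 ->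
  (forall n, beta B n (lattice_pt w) = (l ^ n * w1, l ^ n * w2)) ->
  (mu (annulus c `&` beta B (- k%:Z) @^-1` E) <= mu (strip c (l ^+ k)))%E.
Proof.
move=> l0 bw; have [mE pE _ _ _] := tE; have mbeta := maction_beta uB.
have lk0 : l ^+ k != 0 by rewrite expf_neq0.
(* [sh n] is [B ^ k] applied to [n * w], so conjugation by [B ^ k] turns these shifts into lattice
   translations, for which [E] packs. *)
pose sh n : X := (n%:~R * (l ^+ k) * w1, n%:~R * (l ^+ k) * w2).
pose sigma n p := p + sh n.
have msigma : maction sigma.
  split; last by move=> n; exact: measurable_translation.
  split=> [p|m n p].
    rewrite /sigma /sh !mul0r; exact: addr0.
  rewrite /sigma -addrA; congr (p + _); apply/pair_equal_spec.
  by rewrite /sh intrD /=; split; ring.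
have sigmaE n p : sigma n p = (p.1 + n%:~R * l ^+ k * w1, p.2 + n%:~R * l ^+ k * w2).
  by [].
have mE' : measurable (annulus c `&` beta B (- k%:Z) @^-1` E).
  by apply: measurableI; [exact: measurable_annulus|exact: measurable_act_preimage].
pose v n : int * int := (n * w.1, n * w.2).
have betaw n : beta B (- k%:Z) (sh n) = lattice_pt (v n).
  have -> : sh n = beta B k (lattice_pt (v n)).
    have -> : lattice_pt (v n) =
        (n%:~R * (lattice_pt w).1, n%:~R * (lattice_pt w).2) :> X.
      by rewrite /lattice_pt /= !intrM.
    by rewrite /beta lactZ -/(beta B k _) bw /sh /= !mulrA.
  exact: (actK mbeta).
have packE : packing sigma (annulus c `&` beta B (- k%:Z) @^-1` E).
  move=> n p [_ Ep] [_ En]; have : v n = 0.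
    apply: (pE (v n) (beta B (- k%:Z) p) Ep); rewrite /tau -betaw -/(beta B (- k%:Z) _).
    by move: En; rewrite /= /sigma /beta lactD.
  move=> [/eqP h1 /eqP h2]; apply/eqP; apply: contraNT w0 => n0.
  rewrite [w]surjective_pairing; move: h1 h2; rewrite !mulf_eq0 (negbTE n0) /=.
  by move=> /eqP-> /eqP->.
have := packing_le_sat countable_int (mu := mu) msigma
  (fun n S mS => lebesgue_measure2_translation (sh n) mS)
  mE' (measurable_strip c (l ^+ k)) packE.
apply: le_trans; apply: le_measure; rewrite ?inE//.
  apply: measurableI => //; apply: measurable_sat => //; exact: countable_int.
move=> p [cp Ep]; split=> //; exists (- Num.floor (height p / l ^+ k)).
rewrite sigmaE; split; first by rewrite /annulus /= /enorm eform_shift.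
rewrite height_shift mulrDl mulfK//.
have := floor_itv (height p / l ^+ k); rewrite mulrNz intrD => /andP[h1 h2].
by apply/andP; split; lra.
Qed.

Lemma annulus_finite c : 0 < c -> (mu (annulus c) < +oo)%E.
Proof.
move=> c0; have [l [l0 l1' bw]] := eigenvalue_real.
have [mE _ _ _ cE] := tE; have mbeta := maction_beta uB.
have E1 := double_tile_measure tE.
have mA := measurable_annulus c.
have D0 : 0 < `|\det B| := lt_trans ltr01 detB.
(* Through preimages, [F1 k] is the part of [B ^ k E] in the annulus and [F2 k] is [B ^ (- k) E];
   their measures decay like powers of [l] and of the inverse determinant. *)
pose F1 (k : nat) := annulus c `&` beta B (- k%:Z) @^-1` E.
pose F2 (k : nat) := beta B k @^-1` E.
have mF1 k : measurable (F1 k).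
  by apply: measurableI => //; exact: measurable_act_preimage.
have mF2 k : measurable (F2 k) by exact: measurable_act_preimage.
have mU1 : measurable (\bigcup_k F1 k) by exact: bigcupT_measurable.
have mU2 : measurable (\bigcup_k F2 k) by exact: bigcupT_measurable.
have finF1 : (mu (\bigcup_k F1 k) < +oo)%E.
  have fs : mu (strip c 1) \is a fin_num.
    by rewrite ge0_fin_numE ?measure_ge0// strip_finite.
  apply: (@geometric_bigcup_finite _ _ `|l| (fine (mu (strip c 1)))) => // k.
  apply: (le_trans (annulus_dilate_le c k l0 bw)).
  by rewrite mu_strip ?expf_neq0// normrX mulrC EFinM fineK.
have finF2 : (mu (\bigcup_k F2 k) < +oo)%E.
  apply: (@geometric_bigcup_finite _ _ `|\det B|^-1 1) => //.
  - by rewrite invf_lt1.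
  - move=> k; have := mu_beta k uB mE; rewrite E1 -/(F2 k) -exprnP => h.
    have Dk : `|\det B| ^+ k != 0 by rewrite expf_neq0// gt_eqF.
    have -> : mu (F2 k) = ((`|\det B| ^+ k)^-1%:E * ((`|\det B| ^+ k)%:E * mu (F2 k)))%E.
      by rewrite muleA -EFinM mulVf// mul1e.
    by rewrite -h mule1 mul1r exprVn.
have [N [mN N0 cN]] := cE.
apply: (@le_lt_trans _ _ (mu ((\bigcup_k F1 k `|` \bigcup_k F2 k) `|` N))).
  apply: le_measure; rewrite ?inE//.
    by apply: measurableU => //; exact: measurableU.
  move=> p cp; have [[n En]|np] := pselect (sat (beta B) E p); last by right; exact: cN.
  left; case: n En => n En; first by right; exists n.
  by left; exists n.+1 => //; split=> //; rewrite /= -NegzE.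
rewrite measureU0//; last exact: measurableU.
apply: (le_lt_trans (measureU2 _ mU1 mU2)).
exact: lte_add_pinfty.
Qed.

(** Stretching by 2 along [w] preserves the annulus but doubles its measure, which is finite and at
    least 1 since a unit box fits inside. *)
Lemma no_double_tile_eigenvector : False.
Proof.
have [u [v [c c0 uc]]] := annulus_unit_box.
have mA := measurable_annulus c.
have fin := annulus_finite c0.
have mge1 : (1 <= mu (annulus c))%E.
  rewrite -(mu_unit_box u v); apply: le_measure; rewrite ?inE//.
  exact: measurable_unit_box.
pose M : 'M[R]_2 := \matrix_(i, j) ((i == j)%:R +
  (if i == 0 then w1 else w2) * (if j == 0 then w1 else w2) / nw).
have detM : \det M = 2 by rewrite det2E !mxE /= /nw; field.
have uM : M \in unitmx by rewrite unitmxE detM unitfE; lra.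
have ME p : lact M p = (p.1 + height p * w1, p.2 + height p * w2).
  by rewrite /lact !mxE /= /height; apply/pair_equal_spec; split; ring.
have := lebesgue_measure2_lact uM mA.
have -> : lact M @^-1` annulus c = annulus c.
  by apply/seteqP; split=> p; rewrite /annulus /= /enorm ME eform_shift.
have : mu (annulus c) \is a fin_num by rewrite ge0_fin_numE ?measure_ge0.
move: mge1; case: (mu (annulus c)) => [x| |]//.
rewrite detM lee_fin => x1 _ [] ; rewrite ger0_norm//; lra.
Qed.

End Contracted_lattice_point.

End Eigenform.

(** * Eigenvalues and the rationality of the eigenvector ratio *)

Section Eigenvalues.
Local Open Scope complex_scope.
Context {R : realType}.
Notation normc := (@Normc.normc R).
Implicit Types (A B : 'M[R]_2) (a b x y z : R[i]).

Lemma eigenvalues2_trace_det A (l1 l2 : R[i]) : eigenvalues2 A l1 l2 ->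
  (A 0 0 + A 1 1)%:C = l1 + l2 /\ (\det A)%:C = l1 * l2.
Proof.
move=> eA; have pE : char_poly (complex_mx A) = 'X^2 - (l1 + l2) *: 'X + (l1 * l2)%:P.
  by rewrite [LHS]eA -mul_polyC polyCD polyCM; ring.
have := char_poly_det (complex_mx A); rewrite pE det_map_mx sqrrN expr1n mul1r => <-.
have := char_poly_trace (complex_mx A) (isT : (0 < 2)%N).
rewrite pE /mxtrace sum_ord2 !mxE /= => h; split; last first.
  by rewrite !coefE /= mulr0 subr0 add0r.
move/eqP: h; rewrite !coefE /= mulr1 sub0r addr0 eqr_opp => /eqP ->.
by rewrite rmorphD.
Qed.

(** [l1] is a root of the characteristic polynomial, so [B - l1] is singular and has a nonzero left
    kernel. *)
Lemma row_eigenvector B (l1 l2 : R[i]) :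
  (B 0 0 + B 1 1)%:C = l1 + l2 -> (\det B)%:C = l1 * l2 ->
  exists a b, [/\ (a != 0) || (b != 0),
    a * (B 0 0)%:C + b * (B 1 0)%:C = l1 * a &
    a * (B 0 1)%:C + b * (B 1 1)%:C = l1 * b].
Proof.
move=> trB detB; pose M := complex_mx B - l1%:M.
have trC : (B 0 0)%:C + (B 1 1)%:C = l1 + l2 by rewrite -trB rmorphD.
have : \det M == 0.
  apply/eqP; rewrite det2E !mxE /= !mulr1n !mulr0n !subr0.
  have := detB; rewrite det2E rmorphB !rmorphM /= => h.
  transitivity ((B 0 0)%:C * (B 1 1)%:C - (B 0 1)%:C * (B 1 0)%:C
    - l1 * ((B 0 0)%:C + (B 1 1)%:C) + l1 ^+ 2); first by ring.
  by rewrite h trC; ring.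
move=> /det0P[v v0 vM]; exists (v 0 0), (v 0 1).
have vME j : v 0 0 * M 0 j + v 0 1 * M 1 j = 0.
  by have := congr1 (fun w : 'rV_2 => w 0 j) vM; rewrite mxE sum_ord2 [RHS]mxE.
split.
- rewrite -negb_and; apply: contra_neqN v0 => /andP[/eqP h0 /eqP h1].
  by apply/rowP; apply: ord2P; rewrite mxE.
- have := vME 0; rewrite !mxE /= mulr1n mulr0n subr0 => h.
  by apply/eqP; rewrite -subr_eq0 -[X in _ == X]h; apply/eqP; ring.
- have := vME 1; rewrite !mxE /= mulr1n mulr0n subr0 => h.
  by apply/eqP; rewrite -subr_eq0 -[X in _ == X]h; apply/eqP; ring.
Qed.

(* A non-real ratio would make the conjugate of [l2] the other eigenvalue. *)
Lemma real_eigenvector_ratio B (l2 : R[i]) z :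
  (B 0 0)%:C * z + (B 0 1)%:C = l2 * z -> (B 1 0)%:C * z + (B 1 1)%:C = l2 ->
  complex.Im z != 0 -> normc l2 ^+ 2 = \det B.
Proof.
case: z => x y h1 h2 /= y0.
have l2E : l2 = (B 1 0 * x + B 1 1) +i* (B 1 0 * y).
  by rewrite -h2; apply/eqP; rewrite eq_complex /=; apply/andP; split; apply/eqP; ring.
move/eqP: h1; rewrite l2E eq_complex /= => /andP[/eqP re /eqP im].
have h : B 0 0 = 2 * B 1 0 * x + B 1 1.
  by apply: (mulIf y0); lra.
have {re}re : B 0 1 = B 1 0 * (x ^+ 2 - y ^+ 2) + B 1 1 * x - B 0 0 * x by lra.
rewrite sqr_sqrtr ?addr_ge0 ?sqr_ge0// det2E re h; ring.
Qed.

(** The kernel of the form is a line, so a lattice point in it is proportional to [(x, y)]; if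
    nonzero, it would make the ratio rational. *)
Lemma irrational_ratio_lattice a b x y (t : int * int) :
  (a != 0) || (b != 0) -> a * x + b * y = 0 -> irrational_ratio x y ->
  eform a b (lattice_pt t) = 0 -> t = 0.
Proof.
move=> ab0 axy [y0 [r irr xyr]] t0.
have [s [xE yE]] := eform_ker ab0 axy; have [s' [t1 t2]] := eform_ker ab0 t0.
have xE' : x = r%:C * y by rewrite -[r%:C]xyr divfK.
have h : (t.1%:~R)%:C * y = (t.2%:~R)%:C * x.
  by rewrite [(t.1%:~R)%:C]t1 [(t.2%:~R)%:C]t2 xE yE; ring.
have {h}/complexI h : (t.1%:~R)%:C = (t.2%:~R * r)%:C.
  by apply: (mulIf y0); rewrite h xE' rmorphM mulrA.
have [t20|t20] := eqVneq t.2 0.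
  move: h; rewrite t20 mul0r => /eqP; rewrite intr_eq0 => /eqP t10.
  by rewrite [t]surjective_pairing t10 t20.
case: irr; exists (t.1%:~R / t.2%:~R) => //.
by rewrite fmorph_div /= !ratr_int h mulrC mulKf// intr_eq0.
Qed.

(** If [y = 0], the point [(1, 0)] works. Otherwise the ratio is real by [real_eigenvector_ratio],
    hence rational, and its numerator and denominator form the lattice point. *)
Lemma rational_ratio_lattice B (l2 : R[i]) a b x y :
  (a != 0) || (b != 0) -> a * x + b * y = 0 -> (x != 0) || (y != 0) ->
  (B 0 0)%:C * x + (B 0 1)%:C * y = l2 * x ->
  (B 1 0)%:C * x + (B 1 1)%:C * y = l2 * y ->
  normc l2 ^+ 2 != \det B -> ~ irrational_ratio x y ->
  exists2 w : int * int, w != 0 & eform a b (lattice_pt w) = 0.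
Proof.
move=> ab0 axy xy0 h1 h2 ndet nirr.
have [y0|y0] := eqVneq y 0.
  move: axy xy0; rewrite y0 mulr0 addr0 eqxx orbF => /eqP.
  rewrite mulf_eq0 => /orP[/eqP->|->//] _; exists (1, 0) => //.
  by rewrite /eform /= mul0r mulr0 addr0.
have [z [xz zE]] : exists z, x = z * y /\ x / y = z.
  by exists (x / y); rewrite divfK.
have im0 : complex.Im z = 0.
  apply/eqP; apply: contraT => imz; case/eqP: ndet.
  apply: (real_eigenvector_ratio (z := z)) => //; apply: (mulIf y0).
    by rewrite mulrDl -!mulrA -xz.
  by rewrite mulrDl -mulrA -xz.
pose r := complex.Re z; have zr : z = r%:C.
  by apply/eqP; rewrite eq_complex /= im0 !eqxx.
have [q _ qr] : rational r.
  by apply: contrapT => irr; apply: nirr; split=> //; exists r => //; rewrite zE.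
have d0 : (denq q)%:~R != 0 :> R by rewrite intr_eq0 denq_neq0.
exists (numq q, denq q).
  by apply/eqP => -[_ /eqP]; rewrite (negbTE (denq_neq0 q)).
have -> : eform a b (lattice_pt (numq q, denq q)) = ((denq q)%:~R)%:C * (a * z + b).
  rewrite zr -qr /eform /= /ratr; transitivity
    (a * ((numq q)%:~R / (denq q)%:~R * (denq q)%:~R)%:C + b * ((denq q)%:~R)%:C).
    by rewrite divfK.
  by rewrite !rmorphM; ring.
suff -> : a * z + b = 0 by rewrite mulr0.
by apply: (mulIf y0); rewrite mulrDl -mulrA -xz axy mul0r.
Qed.

End Eigenvalues.

(** * The three cases according to the moduli of the eigenvalues *)

Theorem theorem1p2 (R : realType) (A : 'M[R]_2) (l1 l2 : R[i])
    (unitA : A \in unitmx) (detA : 1 <= `|\det A|)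
    (eigA : eigenvalues2 A l1 l2) (le_l2_l1 : `|l2| <= `|l1|) :
  [/\ `|l1 * l2| = 1 -> ~ (exists T : set 'cV[R]_2, wavelet_set A T),
      1 < `|l1| -> 1 <= `|l2| -> exists T : set 'cV[R]_2, wavelet_set A T
    & 1 < `|l1 * l2| -> `|l2| < 1 ->
      forall v : 'cV[R[i]]_2, eigenvector A^T l2 v ->
      ((exists T : set 'cV[R]_2, wavelet_set A T) <->
       irrational_ratio (v 0 0) (v 1 0))].
Proof.
have [trA detlA] := eigenvalues2_trace_det eigA.
pose B := A^T; have uB : B \in unitmx by rewrite unitmx_tr.
have trB : real_complex R (B 0 0 + B 1 1) = l1 + l2 by rewrite !mxE.
have detBA : \det B = \det A by rewrite det_tr.
have detB : real_complex R (\det B) = l1 * l2 by rewrite detBA.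
have [a [b [ab0 e0 e1]]] := row_eigenvector trB detB.
(* The norm on [R[i]] takes its values in [R[i]]; the bounds are transferred to the real-valued
   [Normc.normc]. *)
have nE (z : R[i]) : `|z| = real_complex R (Normc.normc z) by [].
have gt1 (z : R[i]) : 1 < `|z| -> 1 < Normc.normc z.
  by rewrite nE -[1]/(real_complex R 1) ltcR.
have ge1 (z : R[i]) : 1 <= `|z| -> 1 <= Normc.normc z.
  by rewrite nE -[1]/(real_complex R 1) lecR.
have lt1 (z : R[i]) : `|z| < 1 -> Normc.normc z < 1.
  by rewrite nE -[1]/(real_complex R 1) ltcR.
have normdet : `|\det B| = Normc.normc l1 * Normc.normc l2.
  by rewrite -Normc.normcM -detB normcR.
split.
- move=> n1 [T /(wavelet_set_double_tile uB)[E]].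
  apply: no_double_tile_det1 => //.
  move: n1; rewrite nE Normc.normcM -normdet -[RHS]/(real_complex R 1).
  by move=> /complexI.
- move=> /gt1 l1_gt1 /ge1 l2_ge1.
  have detB1 : 1 < `|\det B|.
    by rewrite normdet (lt_le_trans l1_gt1)// ler_peMr// ltW// (lt_trans ltr01).
  have [E tE] := exists_double_tile uB ab0 e0 e1 l1_gt1 detB1
    (lattice_free_frequently uB trB ab0 e0 e1 l1_gt1 detB1 (fun _ _ _ => l2_ge1)).
  by exists (@coords R @^-1` E)%classic; exact: double_tile_wavelet_set.
- move=> /gt1 l12 /lt1 l2_lt1 v [v0 vE].
  have detB1 : 1 < `|\det B| by rewrite normdet -Normc.normcM.
  have l1_gt1 : 1 < Normc.normc l1.
    apply: (lt_le_trans detB1); rewrite normdet ler_piMr ?normc_ge0//.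
    exact: ltW.
  have l12_neq : l1 != l2.
    by apply: contraTneq l1_gt1 => ->; rewrite -leNgt ltW.
  have h0 := congr1 (fun w : 'cV_2 => w 0 0) vE.
  have h1 := congr1 (fun w : 'cV_2 => w 1 0) vE.
  move: h0 h1; rewrite !mxE !sum_ord2 !mxE => h0 h1.
  have avb : a * v 0 0 + b * v 1 0 = 0.
    by apply: (eigen_eform_ker e0 e1 l12_neq); rewrite !mxE.
  split=> [[T /(wavelet_set_double_tile uB)[E tE]]|irr].
    apply: contrapT => nirr.
    have v0' : (v 0 0 != 0) || (v 1 0 != 0).
      rewrite -negb_and; apply: contra_neqN v0 => /andP[/eqP h /eqP h'].
      by apply/colP; apply: ord2P; rewrite mxE.
    (* The square is at most 1 while the determinant exceeds 1 in modulus; this rules out a non-real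
       ratio. *)
    have ndet : Normc.normc l2 ^+ 2 != \det B.
      apply: contraTneq detB1 => <-; rewrite -leNgt ger0_norm ?sqr_ge0//.
      by rewrite exprn_ile1 ?normc_ge0// ltW.
    have [w w0 ew0] : exists2 w : int * int, w != 0 & eform a b (lattice_pt w) = 0.
      by apply: (rational_ratio_lattice (B := B) ab0 avb v0' _ _ ndet nirr);
        rewrite !mxE.
    exact: (no_double_tile_eigenvector uB trB ab0 e0 e1 l1_gt1 detB1 w0 ew0 l2_lt1 tE).
  (* Vacuous: an irrational ratio leaves no nonzero lattice point in the eigenline of [l2]. *)
  have noeig (t : int * int) : t != 0 -> eform a b (lattice_pt t) = 0 ->
      1 <= Normc.normc l2.
    by move=> /eqP t0 /(irrational_ratio_lattice ab0 avb irr).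
  have [E tE] := exists_double_tile uB ab0 e0 e1 l1_gt1 detB1
    (lattice_free_frequently uB trB ab0 e0 e1 l1_gt1 detB1 noeig).
  by exists (@coords R @^-1` E)%classic; exact: double_tile_wavelet_set.
Qed.
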